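(* Let $\mu$ be a nonnegative Borel measure on $\mathbb{R}^+$ with $\mu(\mathbb{R}^+)\in(0,\infty)$, let $\sigma\in C(\mathbb{R}^+;\mathbb{R})$, let $B$ be a standard one-dimensional Brownian motion, and let $f:\mathbb{R}\to\mathbb{R}$ be locally Lipschitz continuous with $f(x)>0$ for $x>0$ and $\lim_{x\to\infty}f(x)=\infty$. Suppose there is $\phi\in C^1(\mathbb{R}^+;(0,\infty))$ with $\phi'(x)>0$ for all $x\ge0$, $\lim_{x\to\infty}\phi(x)=\infty$, $\lim_{x\to\infty}\phi'(x)=0$, and $$\lim_{x\to\infty}\frac{f(x)}{\phi(x)}=1,\qquad\lim_{|x|\to\infty}\frac{|f(x)|}{\phi(|x|)}=1.$$ Let $X$ be the unique strong (continuous) solution of $$X(t)=X(0)+\int_0^t m(t-s)f(X(s))\,ds+\int_0^t\sigma(s)\,dB(s),\quad t\ge0,\qquad m(t)=\mu([0,t]).$$ Let $F(x)=\int_1^x\frac{du}{f(u)}$, $x>0$, $$\Sigma(t)=\sqrt{2\left(\int_0^t\sigma^2(s)\,ds\right)\log\log\left(\int_0^t\sigma^2(s)\,ds\right)},\qquad L_f(\Sigma)=\lim_{t\to\infty}\frac{\Sigma(t)}{\mu(\mathbb{R}^+)\int_{t_0}^t f(\Sigma(s))\,ds}.$$ (a) If $\sigma\notin L^2(0,\infty)$ and $L_f(\Sigma)=0$, then $$\limsup_{t\to\infty}\frac{F(|X(t)|)}{\mu(\mathbb{R}^+)t}\le1\quad\text{a.s.}$$ (b) If $\sigma\in L^2(0,\infty)$,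 then $L_f(\Sigma)=0$ (whenever $\Sigma(t)$ is defined for all large $t$, i.e. $\int_0^\infty\sigma^2(s)\,ds>e$) and $$\limsup_{t\to\infty}\frac{F(|X(t)|)}{\mu(\mathbb{R}^+)t}\le1\quad\text{a.s.}$$
   Context: $\mathbb{R}^+=[0,\infty)$. The underlying filtered probability space is complete with right-continuous filtration, $B$ is a Brownian motion with respect to it, and $X(0)$ is a real-valued $\mathcal{F}_0$-measurable initial value. $\Sigma(t)$ is considered only for $t\ge t_0$, where $t_0$ is any fixed time with $\int_0^{t_0}\sigma^2(s)\,ds>e$ (the value of $L_f(\Sigma)$ does not depend on the choice of $t_0$). $F(0)$ is understood as $\lim_{x\to0^+}F(x)\in[-\infty,0)$. *)

(* Defs.v *)
From HB Require Import structures.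
From mathcomp Require Import all_boot all_order all_algebra.
From mathcomp Require Import all_classical all_reals all_analysis.

Set Implicit Arguments.
Unset Strict Implicit.
Unset Printing Implicit Defensive.
Import Order.TTheory GRing.Theory Num.Theory.
Import numFieldNormedType.Exports.

Local Open Scope classical_set_scope.
Local Open Scope ring_scope.

Section deterministic.
Context {R : realType}.
Implicit Types (f phi sigma : R -> R).
Local Notation leb := (@lebesgue_measure R).

Definition locally_lipschitz f : Prop :=
  forall x : R, exists2 U : set R, nbhs x U & [lipschitz f y | y in U].

(* dphi is the derivative of phi on [0, +oo[, one-sided at the end point 0 *)
Definition is_C1_Rplus phi (dphi : R -> R) : Prop :=
  {within `[0, +oo[, continuous dphi} /\
  forall x, 0 <= x ->
    (phi y - phi x) / (y - x) @[y --> within `[0, +oo[ (dnbhs x)] --> dphi x.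

(* g x --> l as |x| --> +oo *)
Definition cvg_at_abs_infty (g : R -> R) (l : R) : Prop :=
  forall e : R, 0 < e -> \forall M \near +oo, forall x, M <= `|x| ->
    `|g x - l| < e.

Definition variance_int sigma (t : R) : R :=
  \int[leb]_(s in `[0, t]) (sigma s ^+ 2).

Definition L2_Rplus sigma : Prop :=
  (\int[leb]_(s in `]0%R, +oo[) (sigma s ^+ 2)%:E < +oo)%E.

Definition lil_scale sigma (t : R) : R :=
  Num.sqrt (2 * variance_int sigma t * ln (ln (variance_int sigma t))).

Definition Lf_quotient f sigma (M t0 t : R) : R :=
  lil_scale sigma t /
    (M * \int[leb]_(s in `[t0, t]) f (lil_scale sigma s)).

(* int_1^x du / f(u), with the orientation convention int_1^x = - int_x^1 *)
Definition primitive_recip f (x : R) : R :=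
  if 1 <= x then \int[leb]_(u in `[1, x]) (f u)^-1
  else - \int[leb]_(u in `[x, 1]) (f u)^-1.

(* extended to x = 0 by the right limit, which may be -oo; only evaluated at
   x >= 0 *)
Definition Ffun f (x : R) : \bar R :=
  if 0 < x then (primitive_recip f x)%:E
  else lim ((primitive_recip f y)%:E @[y --> 0^'+]).

(* A list of triples (a, b, c) stands for the sum of the c * \1_(]a, b]). *)
Definition step_on (t : R) (s : seq (R * R * R)) : Prop :=
  forall a b c, (a, b, c) \in s -> 0 <= a <= b /\ b <= t.

Definition step_fun (s : seq (R * R * R)) (x : R) : R :=
  \sum_(q <- s) q.2 * \1_(`]q.1.1, q.1.2]) x.

End deterministic.

Section stochastic.
Context {R : realType} {d : measure_display} {T : measurableType d}.
Variable P : probability T R.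
Implicit Types (X B : R -> T -> R) (filt : R -> set (set T)).
Local Notation leb := (@lebesgue_measure R).

(* Processes and filtrations are indexed by R; only times t >= 0 matter. *)

Record usual_conditions filt : Prop := {
  uc_complete : measure_is_complete P;
  uc_sigma : forall t, 0 <= t -> sigma_algebra [set: T] (filt t);
  uc_sub : forall t, 0 <= t -> filt t `<=` measurable;
  uc_mono : forall s t, 0 <= s -> s <= t -> filt s `<=` filt t;
  uc_null : P.-negligible `<=` filt 0;
  uc_right : forall t, 0 <= t ->
    \bigcap_(u in [set u | t < u]) filt u `<=` filt t }.

Definition adapted filt X : Prop :=
  forall t, 0 <= t -> forall Y : set R, measurable Y -> filt t (X t @^-1` Y).

Definition as_continuous X : Prop :=
  {ae P, forall w, {within `[0, +oo[, continuous (fun t => X t w)}}.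

Definition increment X (s t : R) (w : T) : R := X t w - X s w.

Record brownian_motion filt B : Prop := {
  bm_adapted : adapted filt B;
  bm_zero : {ae P, forall w, B 0 w = 0};
  bm_indep : forall s t, 0 <= s -> s < t ->
    forall (A : set T) (Y : set R), filt s A -> measurable Y ->
      P (A `&` increment B s t @^-1` Y) = (P A * P (increment B s t @^-1` Y))%E;
  bm_normal : forall s t, 0 <= s -> s < t ->
    forall Y : set R, measurable Y ->
      P (increment B s t @^-1` Y) = normal_prob 0 (Num.sqrt (t - s)) Y;
  bm_continuous : as_continuous B }.

Definition step_int B (s : seq (R * R * R)) (w : T) : R :=
  \sum_(q <- s) q.2 * increment B q.1.1 q.1.2 w.

(* The Ito integral over [0, t] of a deterministic integrand: the L^2(P) limit
   of the integrals of step functions that converge to it in L^2([0, t]). By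
   the Ito isometry it does not depend on the approximating sequence. *)
Definition is_ito_integral B (sigma : R -> R) (t : R) (Y : T -> R) : Prop :=
  measurable_fun [set: T] Y /\
  exists s : nat -> seq (R * R * R),
    [/\ forall k, step_on t (s k),
        (\int[leb]_(x in `[0%R, t]) ((sigma x - step_fun (s k) x) ^+ 2)%:E
           @[k --> \oo] --> 0)%E
      & (\int[P]_w ((Y w - step_int B (s k) w) ^+ 2)%:E @[k --> \oo] --> 0)%E].

(* A continuous adapted version I of t |-> int_0^t sigma dB. *)
Record ito_process filt B (sigma : R -> R) (I : R -> T -> R) : Prop := {
  ip_adapted : adapted filt I;
  ip_continuous : as_continuous I;
  ip_integral : forall t, 0 <= t -> is_ito_integral B sigma t (I t) }.

Record strong_solution filt B (mu : set R -> \bar R) (f sigma : R -> R) X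
    : Prop := {
  ss_adapted : adapted filt X;
  ss_continuous : as_continuous X;
  ss_equation : exists2 I : R -> T -> R, ito_process filt B sigma I &
    {ae P, forall w, forall t, 0 <= t ->
      X t w = X 0 w
            + \int[leb]_(s in `[0, t]) (fine (mu `[0, t - s]%classic) * f (X s w))
            + I t w} }.

Definition limsup_le1 f (M : R) X : Prop :=
  {ae P, forall w,
    (limf_esup (fun t : R => Ffun f `|X t w| / (M * t)%:E)
       (pinfty_nbhs R) <= 1)%E}.

End stochastic.

(* Main.v *)
Require Import Defs.
From HB Require Import structures.
From mathcomp Require Import all_boot all_order all_algebra.
From mathcomp Require Import all_classical all_reals all_analysis.
From mathcomp Require Import ring lra measurable_realfun.

Set Implicit Arguments.
Unset Strict Implicit.
Unset Printing Implicit Defensive.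
Import Order.TTheory GRing.Theory Num.Theory.
Import numFieldNormedType.Exports.

Local Open Scope classical_set_scope.
Local Open Scope ring_scope.

(* The noise I(t) = int_0^t sigma dB is a continuous Gaussian process with
   independent increments and variance V(t).  An exponential maximal inequality
   on the blocks {V <= e^n} and the Borel-Cantelli lemma give a law of the
   iterated logarithm with a non-optimal constant C: |I| <= C Sigma eventually if
   V is unbounded, and |I| is bounded otherwise.  The value of C is irrelevant,
   because L_f(Sigma) = 0 makes C Sigma(t) smaller than any multiple
   delta M J(t) of the absolutely continuous J(t) = int_{t0}^t f(Sigma).  Hence
   |X| is dominated by Z(t) = K + int_a^t (M |f(X)| + delta M f(Sigma)); as Z
   dominates both |X| and Sigma, and |f(y)| <= (1 + delta) f(z) for |y| <= z and
   z large, Z' <= (1 + delta)^2 M f(Z), so that F(Z(t)) grows at most like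
   (1 + delta)^2 M t.  For bounded I the same works without the Sigma term.  The
   case distinction is on whether V is bounded, which covers (a) and (b). *)

(** * Integrals of continuous functions and Bihari's comparison *)

Section deterministic.
Context {R : realType}.
Implicit Types (f g : R -> R).
Local Notation leb := (@lebesgue_measure R).

(** The noise is known only through [is_ito_integral]: at each fixed time it is an L^2(P) limit of
    integrals of step functions, and the approximations at different times are unrelated. Pathwise
    statements are therefore built up from finitely many times. A maximal inequality for one step
    function on a grid, with a bound independent of the number of grid points, passes to I at
    finitely many times by approximation in probability, to all rational times by continuity from
    below, and to all times by continuity of the paths. The approximation costs constant factors in
    the level and in the variance, hence the non-optimal C. On the deterministic side the obstacle
    is that a noise path has no derivative to work with, so |X| itself satisfies no differential
    inequality. Trading the noise for an integral gives a majorant that is differentiable with a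
    known derivative, to which a comparison of Bihari type applies; the comparison only has to be
    run after a large time, since everything earlier goes into the constant K. *)

Lemma continuous_within_integrable f (a b x : R) :
  a <= b -> {within `[a, +oo[, continuous f} ->
  leb.-integrable `[b, x] (EFin \o f).
Proof.
move=> ab fc; apply: continuous_compact_integrable; first exact: segment_compact.
by apply: continuous_subspaceW fc; apply: subset_itv; rewrite bnd_simp.
Qed.

Lemma continuous_within_at f (a x : R) :
  {within `[a, +oo[, continuous f} -> a < x -> {for x, continuous f}.
Proof.
move=> fc ax; have fo : {within `]a, +oo[, continuous f}.
  by apply: continuous_subspaceW fc; apply: subset_itv; rewrite bnd_simp.
move: fo; rewrite continuous_open_subspace; last exact: interval_open.
by apply; rewrite inE /= in_itv/= ax.
Qed.

Lemma is_derive_integral f (a x : R) :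
  {within `[a, +oo[, continuous f} -> a < x ->
  is_derive x 1 (fun y => \int[leb]_(s in `[a, y]) f s) (f x).
Proof.
move=> fc ax; have [||//||d1 d2] := @continuous_FTC1_closed R f a x (x + 1).
- by rewrite ltrDl.
- exact: continuous_within_integrable fc.
- exact: continuous_within_at fc _.
by apply: DeriveDef; [exact: d1 | rewrite -derive1E].
Qed.

Lemma continuous_integral f (a t : R) : a <= t ->
  {within `[a, +oo[, continuous f} ->
  {within `[a, t], continuous (fun y => \int[leb]_(s in `[a, y]) f s)}.
Proof.
move=> at_ fc; apply: parameterized_integral_continuous => //.
exact: continuous_within_integrable fc.
Qed.

(* Comparison with the solution of z' = c f(z), which satisfies
   F(z(t)) = F(z(a)) + c (t - a). *)
Lemma bihari f g (K c a t : R) :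
  (forall x, 0 < x -> 0 < f x) -> continuous f ->
  {within `[a, +oo[, continuous g} -> 1 < K -> a <= t ->
  (forall s, a < s -> 0 <= g s <= c * f (K + \int[leb]_(r in `[a, s]) g r)) ->
  primitive_recip f (K + \int[leb]_(r in `[a, t]) g r) <=
  primitive_recip f K + c * (t - a).
Proof.
move=> f0 fc gc K1 at_ gle.
pose Z (s : R) := K + \int[leb]_(r in `[a, s]) g r; rewrite -/(Z t).
have Za : Z a = K by rewrite /Z set_itv1 Rintegral_set1 addr0.
have fVc : {within `[1, +oo[, continuous (fun x => (f x)^-1)}.
  apply: continuous_in_subspaceT => x; rewrite inE/= in_itv/= andbT => x1.
  by apply: cvgV; [rewrite gt_eqF// f0// (lt_le_trans ltr01) | exact: fc].
pose F (x : R) := \int[leb]_(u in `[1, x]) (f u)^-1.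
have FE (x : R) : 1 <= x -> primitive_recip f x = F x by rewrite /primitive_recip => ->.
have dF (x : R) : 1 < x -> is_derive x 1 F (f x)^-1 by exact: is_derive_integral.
have dZ (s : R) : a < s -> is_derive s 1 Z (g s).
  by move=> as_; rewrite -[g s]add0r; apply: is_deriveD; exact: is_derive_integral.
have Zge (s : R) : a <= s -> K <= Z s.
  move=> as_; rewrite lerDl; rewrite -Rintegral_itv_obnd_cbnd; last first.
    apply: integrableS (@continuous_within_integrable g a a s (lexx a) gc) => //.
    by apply: subset_itv; rewrite bnd_simp.
  by apply: Rintegral_ge0 => r /=; rewrite in_itv/= => /andP[/gle/andP[]].
(* Strictness matters: [dF] is available only to the right of 1, and F has to be continuous also at
   [Z a = K]. *)
have Z1 (s : R) : a <= s -> 1 < Z s by move=> /Zge; exact: lt_le_trans.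
rewrite !FE ?(ltW (Z1 _ at_)) ?(ltW K1)// -lerBlDr.
pose H (s : R) := F (Z s) - c * (s - a).
have dH (s : R) : a < s -> is_derive s 1 H (g s * (f (Z s))^-1 - c).
  move=> as_; apply: is_deriveB.
    have := @is_derive1_comp R F Z s (f (Z s))^-1 (g s)
      (dF _ (Z1 _ (ltW as_))) (dZ _ as_).
    by rewrite [_ * g s]mulrC.
  have -> : (fun s => c * (s - a)) = c *: (fun s => s - a) :> (R -> R) by [].
  rewrite -[c in is_derive _ _ _ c]mulr1 -[X in c * X]subr0.
  exact: is_deriveZ.
have -> : F K = H a by rewrite /H Za subrr mulr0 subr0.
suff : H t <= H a by [].
apply: (@ler0_derive1_le_cc R H a t) => //; rewrite ?in_itv/= ?lexx ?at_//.
- by move=> x; rewrite in_itv/= => /andP[ax _]; have [] := dH x ax.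
- move=> x; rewrite in_itv/= => /andP[ax _].
  rewrite derive1E; have [_ ->] := dH x ax.
  rewrite subr_le0 ler_pdivrMr; first by have /andP[] := gle x ax.
  by rewrite f0// (lt_trans ltr01)// Z1// ltW.
- have Zc : {within `[a, t], continuous Z}.
    move=> x; apply: cvgD; first exact: cvg_cst.
    exact: continuous_integral.
  rewrite continuous_subspace_in => x; rewrite inE/= in_itv/= => /andP[ax _].
  apply: cvgB.
    apply: (@cvg_comp _ _ _ Z F _ _ _ (Zc x)).
    apply: differentiable_continuous; apply/derivable1_diffP.
    by have [] := dF _ (Z1 _ ax).
  suff cc : {within `[a, t], continuous (fun s => c * (s - a))} by exact: cc.
  by apply: continuous_subspaceT => y; apply: cvgM; [exact: cvg_cst |
     apply: cvgB; [exact: cvg_id | exact: cvg_cst]].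
Qed.
End deterministic.

(** * The variance of the noise *)

Section variance.
Context {R : realType}.
Variable sigma : R -> R.
Hypothesis hsigma : {within `[0, +oo[, continuous sigma}.
Local Notation leb := (@lebesgue_measure R).
Local Notation V := (variance_int sigma).

Lemma continuous_within_sqr : {within `[0, +oo[, continuous (fun s => sigma s ^+ 2)}.
Proof. by move=> x; apply: continuousM; exact: hsigma. Qed.

Lemma integrable_sqr (t : R) : leb.-integrable `[0, t] (fun s => (sigma s ^+ 2)%:E).
Proof.
exact: (@continuous_within_integrable R (fun s => sigma s ^+ 2) 0 0 t (lexx 0)
  continuous_within_sqr).
Qed.

Lemma variance_intE (t : R) :
  (\int[leb]_(s in `[0%R, t]) (sigma s ^+ 2)%:E = (V t)%:E)%E.
Proof. by rewrite fineK//; apply: integrable_fin_num => //; exact: integrable_sqr. Qed.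

Lemma measurable_sigma (t : R) : measurable_fun `[0, t] sigma.
Proof.
have := @continuous_within_integrable R sigma 0 0 t (lexx 0) hsigma.
by move=> /measurable_int/measurable_EFinP.
Qed.

Lemma le_variance_int (s t : R) : s <= t -> V s <= V t.
Proof.
move=> st; rewrite -lee_fin -!variance_intE; apply: ge0_subset_integral => //.
- by case/integrableP: (integrable_sqr t).
- by move=> x _; rewrite lee_fin sqr_ge0.
- by apply: subset_itv; rewrite bnd_simp.
Qed.

End variance.

(** * Gaussian increments and exponential maximal inequality *)

Section gaussian.
Context {R : realType}.
Local Notation leb := (@lebesgue_measure R).
Local Open Scope ereal_scope.

Import HBNNSimple.

(** For indicators this is the definition of [normal_prob] by its density; linearity extends it to
    simple functions and monotone convergence to nonnegative ones. *)
Lemma ge0_integral_normal_prob (m s : R) (g : measurableTypeR R -> \bar R) :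
  measurable_fun [set: measurableTypeR R] g -> (forall x, 0 <= g x) ->
  \int[normal_prob m s]_x g x = \int[leb]_x (g x * (normal_pdf m s x)%:E).
Proof.
move=> mg g0; pose h := nnsfun_approx measurableT mg.
have h_cvg x : EFin \o h ^~ x @ \oo --> g x by apply: cvg_nnsfun_approx.
have hnd x m' n : (m' <= n)%N -> (h m' x <= h n x)%R.
  by move=> mn; exact/lefP/nd_nnsfun_approx.
have p0 x : 0 <= (normal_pdf m s x)%:E by rewrite lee_fin normal_pdf_ge0.
have mp : measurable_fun [set: measurableTypeR R]
    (fun x : measurableTypeR R => (normal_pdf m s x)%:E).
  by apply/measurable_EFinP; exact: measurable_normal_pdf.
transitivity (limn (fun n => \int[normal_prob m s]_x (h n x)%:E)).
  rewrite -monotone_convergence//.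
  - by apply: eq_integral => x _; apply/esym/cvg_lim => //; exact: h_cvg.
  - by move=> n; exact/measurable_EFinP.
  - by move=> n x _; rewrite lee_fin.
  - by move=> x _ m' n mn; rewrite lee_fin hnd.
transitivity (limn (fun n => \int[leb]_x ((h n x)%:E * (normal_pdf m s x)%:E))).
  congr (limn _); apply/funext => n.
  have mi (r : R) : measurable_fun [set: measurableTypeR R]
      (fun x : measurableTypeR R => (r * \1_(h n @^-1` [set r]) x)%:E).
    by apply/measurable_EFinP; exact: measurable_funM.
  transitivity (\sum_(r \in range (h n)) \int[normal_prob m s]_x
      (r * \1_(h n @^-1` [set r]) x)%:E).
    under eq_integral do rewrite fimfunE -fsumEFin//.
    rewrite ge0_integral_fsum// => r x _; exact: nnfun_muleindic_ge0.
  transitivity (\sum_(r \in range (h n)) \int[leb]_x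
      ((r * \1_(h n @^-1` [set r]) x)%:E * (normal_pdf m s x)%:E)); last first.
    rewrite -ge0_integral_fsum//.
    - apply: eq_integral => x _; rewrite [in RHS]fimfunE -fsumEFin//.
      by rewrite ge0_mule_fsuml// => r; exact: nnfun_muleindic_ge0.
    - by move=> r; exact: emeasurable_funM.
    - by move=> r x _; rewrite mule_ge0//; exact: nnfun_muleindic_ge0.
  apply: eq_fsbigr => r; rewrite inE => -[z _ hz].
  have r0 : 0 <= r%:E by rewrite lee_fin -hz.
  have mA : measurable (h n @^-1` [set r]) by [].
  under eq_integral do rewrite EFinM.
  under [RHS]eq_integral do rewrite EFinM -muleA.
  have mi1 : measurable_fun [set: measurableTypeR R]
      (fun x : measurableTypeR R => (\1_(h n @^-1` [set r]) x : R)%:E).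
    by apply/measurable_EFinP; exact: measurable_indic.
  rewrite !ge0_integralZl//; [|exact: emeasurable_funM|by move=> x _; exact: mule_ge0].
  rewrite integral_indic// setIT; congr (_ * _).
  rewrite /normal_prob [LHS]integral_mkcond; apply: eq_integral => x _.
  by rewrite epatch_indic /= muleC.
rewrite -monotone_convergence//.
- apply: eq_integral => x _; apply/cvg_lim => //.
  by apply: cvgeZr; [|exact: h_cvg].
- by move=> n; apply: emeasurable_funM => //; apply/measurable_EFinP.
- by move=> n x _; rewrite mule_ge0// lee_fin.
- by move=> x _ m' n mn; rewrite lee_wpmul2r// lee_fin hnd.
Qed.

(** Completing the square: the exponential factor turns the centred density into a constant times
    the normal density with mean [th * s ^+ 2], which has total mass 1. *)
Lemma normal_mgf (s th : R) : (s != 0)%R ->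
  \int[normal_prob 0 s]_x (expR (th * x))%:E = (expR (th ^+ 2 * s ^+ 2 / 2))%:E.
Proof.
move=> s0; rewrite ge0_integral_normal_prob.
- transitivity (\int[leb]_x ((expR (th ^+ 2 * s ^+ 2 / 2))%:E *
                             (normal_pdf (th * s ^+ 2) s x)%:E)).
    apply: eq_integral => x _; rewrite -!EFinM; congr EFin.
    rewrite !normal_pdfE// mulrCA [RHS]mulrCA; congr (_ * _)%R.
    by rewrite /normal_fun -!expRD; congr expR; field.
  rewrite integralZl//; last exact: integrable_normal_pdf.
  by rewrite integral_normal_pdf mule1.
- by apply/measurable_EFinP/measurableT_comp => //; exact: mulrl_measurable.
- by move=> x; rewrite lee_fin expR_ge0.
Qed.

End gaussian.

(** * Factorisation of expectations under independence *)

Section independence.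
Context {R : realType} {d : measure_display} {T : measurableType d}.
Variable P : probability T R.
Local Open Scope ereal_scope.

(** The law of the pair (G, D) agrees with the product of the marginal laws on rectangles, hence
    everywhere by uniqueness of the product measure; Tonelli's theorem then separates the
    factors. *)
Lemma expectation_indep (G D : T -> R) (g h : R -> R) :
  measurable_fun setT G -> measurable_fun setT D ->
  measurable_fun setT g -> measurable_fun setT h ->
  (forall x, 0 <= g x)%R -> (forall x, 0 <= h x)%R ->
  (forall Y Z : set R, measurable Y -> measurable Z ->
     P (G @^-1` Y `&` D @^-1` Z) = P (G @^-1` Y) * P (D @^-1` Z)) ->
  \int[P]_w (g (G w) * h (D w))%:E =
  \int[P]_w (g (G w))%:E * \int[P]_w (h (D w))%:E.
Proof.
move=> mG mD mg mh g0 h0 ind.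
pose GD w := (G w, D w).
have mGD : measurable_fun setT GD by exact: measurable_fun_pair.
pose m1 := distribution P (mfun_Sub (mem_set mG)).
pose m2 := distribution P (mfun_Sub (mem_set mD)).
pose m' := distribution P (mfun_Sub (mem_set mGD)).
have m'E (X : set (R * R)) : measurable X -> (m1 \x m2) X = m' X.
  apply: product_measure_unique => Y Z mY mZ; rewrite -ind//.
have mgh : measurable_fun setT (fun z : R * R => (g z.1 * h z.2)%:E).
  apply/measurable_EFinP/measurable_funM; exact: measurableT_comp.
transitivity (\int[m']_z (g z.1 * h z.2)%:E).
  rewrite ge0_integral_pushforward//.
  by move=> z _; rewrite lee_fin mulr_ge0.
transitivity (\int[m1 \x m2]_z (g z.1 * h z.2)%:E).
  by apply: eq_measure_integral => A mA _; symmetry; exact: m'E.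
rewrite fubini_tonelli1//; last by move=> z; rewrite lee_fin mulr_ge0.
transitivity (\int[m1]_x ((g x)%:E * \int[m2]_y (h y)%:E)).
  apply: eq_integral => x _; rewrite /fubini_F/=.
  under eq_integral do rewrite EFinM.
  by rewrite ge0_integralZl ?lee_fin//;
    [exact/measurable_EFinP | move=> y _; rewrite lee_fin].
rewrite ge0_integralZr//; first last.
- by apply: integral_ge0 => y _; rewrite lee_fin.
- by move=> x _; rewrite lee_fin.
- exact/measurable_EFinP.
by congr (_ * _); rewrite ge0_integral_pushforward//;
  [exact/measurable_EFinP | move=> x _; rewrite lee_fin |
   exact/measurable_EFinP | move=> x _; rewrite lee_fin].
Qed.
End independence.

Section brownian.
Context {R : realType} {d : measure_display} {T : measurableType d}.
Variable P : probability T R.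
Variable filt : R -> set (set T).
Hypothesis hfilt : usual_conditions P filt.
Variable B : R -> T -> R.
Hypothesis hB : brownian_motion P filt B.
Local Notation leb := (@lebesgue_measure R).

Lemma measurable_ge_set (G : T -> R) (x : R) :
  measurable_fun [set: T] G -> measurable [set w | x <= G w].
Proof.
move=> mG; have := mG measurableT `[x, +oo[%classic (measurable_itv _).
by rewrite setTI; congr measurable; apply/seteqP; split => w /=;
  rewrite in_itv/= andbT.
Qed.

Definition filt_measurable (s : R) (G : T -> R) : Prop :=
  forall Y : set R, measurable Y -> filt s (G @^-1` Y).

(** Passing to the type generated by [filt s] makes the closure properties of measurable functions
    available for a single member of the filtration; as [filt s] is a sigma-algebra, generating adds
    no sets. *)
Lemma filt_measurableP (s : R) (G : T -> R) : 0 <= s ->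
  filt_measurable s G <->
  measurable_fun [set: g_sigma_algebraType (filt s)] G.
Proof.
move=> s0; have E := sigma_algebra_id (uc_sigma hfilt s0).
split => [h _ Y mY|h Y mY].
  by rewrite setTI; apply: sub_sigma_algebra; exact: h.
have := h measurableT Y mY; rewrite setTI /measurable/=.
by rewrite E.
Qed.

Lemma filt_measurable_fun (s : R) (G : T -> R) : 0 <= s ->
  filt_measurable s G -> measurable_fun [set: T] G.
Proof. by move=> s0 h _ Y mY; rewrite setTI; exact/(uc_sub hfilt s0)/h. Qed.

Lemma filt_measurable_le (s t : R) (G : T -> R) : 0 <= s -> s <= t ->
  filt_measurable s G -> filt_measurable t G.
Proof. by move=> s0 st h Y mY; exact/(uc_mono hfilt s0 st)/h. Qed.

Lemma filt_measurable_brownian (t : R) : 0 <= t -> filt_measurable t (B t).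
Proof. by move=> t0; exact: bm_adapted hB t t0. Qed.

Lemma filt_measurable_increment (s t : R) : 0 <= s -> s <= t ->
  filt_measurable t (increment B s t).
Proof.
move=> s0 st; have t0 := le_trans s0 st.
apply/(filt_measurableP _ t0); apply: measurable_funB; apply/(filt_measurableP _ t0).
  exact: filt_measurable_brownian.
by apply: (filt_measurable_le s0 st); exact: filt_measurable_brownian.
Qed.

Lemma measurable_brownian (t : R) : 0 <= t -> measurable_fun [set: T] (B t).
Proof.
by move=> t0; apply: (filt_measurable_fun t0); exact: filt_measurable_brownian.
Qed.

Lemma measurable_increment (s t : R) : 0 <= s -> 0 <= t ->
  measurable_fun [set: T] (increment B s t).
Proof. by move=> s0 t0; apply: measurable_funB; exact: measurable_brownian. Qed.

Lemma increment_mgf (s t th : R) : 0 <= s -> s <= t ->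
  (\int[P]_w (expR (th * increment B s t w))%:E
    = (expR (th ^+ 2 * (t - s) / 2))%:E)%E.
Proof.
move=> s0; rewrite le_eqVlt => /predU1P[<-|st].
  under eq_integral do rewrite /increment subrr mulr0 expR0.
  by rewrite integral_cst//= probability_setT mule1 subrr mulr0 mul0r expR0.
have mI : @measurable_fun _ _ T (measurableTypeR R) setT (increment B s t).
  by apply: measurable_increment => //; rewrite (le_trans s0)// ltW.
have st0 : Num.sqrt (t - s) != 0 by rewrite gt_eqF// sqrtr_gt0 subr_gt0.
have E : Num.sqrt (t - s) ^+ 2 = t - s by rewrite sqr_sqrtr// subr_ge0 ltW.
transitivity (\int[normal_prob 0 (Num.sqrt (t - s))]_x (expR (th * x))%:E)%E; last first.
  by rewrite normal_mgf// E.
pose D := distribution P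
  (@mfun_Sub _ _ T (measurableTypeR R) (increment B s t) (mem_set mI)).
transitivity (\int[D]_x (expR (th * x))%:E)%E; last first.
  by apply: eq_measure_integral => A mA _; exact: (bm_normal hB s0 st).
rewrite ge0_integral_pushforward//.
by apply/measurable_EFinP/measurableT_comp => //; exact: mulrl_measurable.
Qed.

(** The case [s = t] is included because the grids used below may repeat points. *)
Lemma expectation_increment (s t th : R) (G : T -> R) (g : R -> R) :
  0 <= s -> s <= t -> filt_measurable s G -> measurable_fun setT g ->
  (forall x, 0 <= g x) ->
  (\int[P]_w (g (G w) * expR (th * increment B s t w))%:E =
   \int[P]_w (g (G w))%:E * (expR (th ^+ 2 * (t - s) / 2))%:E)%E.
Proof.
move=> s0 st hG mg g0; have t0 := le_trans s0 st.
rewrite -increment_mgf//.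
apply: (@expectation_indep _ _ _ P G (increment B s t) g
  (fun x => expR (th * x))) => //.
- exact: filt_measurable_fun hG.
- exact: measurable_increment.
- by apply: measurableT_comp => //; exact: mulrl_measurable.
move=> Y Z mY mZ; move: st; rewrite le_eqVlt => /predU1P[<-|st]; last first.
  by apply: (bm_indep hB s0 st) => //; exact: hG.
have incr0 : increment B s s = cst 0 by apply/funext => w; rewrite /increment subrr.
rewrite incr0 preimage_cst; case: ifPn => _.
  by rewrite setIT probability_setT mule1.
by rewrite setI0 measure0 mule0.
Qed.

(* The exponent sum (c dB - c^2 dr / 2) of the exponential martingale, frozen at the
   first time it reaches lam. The stopped martingale still has expectation 1, so
   that the maximal inequality reduces to Markov's inequality at the final time. *)
Fixpoint stopped (c r : nat -> R) (lam : R) (n : nat) : T -> R :=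
  if n is m.+1 then fun w =>
    let x := stopped c r lam m w in
    if lam <= x then x
    else x + (c m * increment B (r m) (r m.+1) w
              - c m ^+ 2 * (r m.+1 - r m) / 2)
  else fun=> 0.

Lemma filt_measurable_stopped (c r : nat -> R) (lam : R) (n : nat) :
  0 <= r 0%N -> {homo r : m n / (m <= n)%N >-> m <= n} ->
  filt_measurable (r n) (stopped c r lam n).
Proof.
move=> r0 rh; have rp m : 0 <= r m by exact: le_trans r0 (rh _ _ _).
elim: n => [|n IH] /=; first by apply/filt_measurableP.
have {}IH : filt_measurable (r n.+1) (stopped c r lam n).
  by apply: filt_measurable_le IH => //; exact: rh.
have hi : filt_measurable (r n.+1) (increment B (r n) (r n.+1)).
  by apply: filt_measurable_increment => //; exact: rh.
move/(filt_measurableP _ (rp _)) : IH => IH.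
move/(filt_measurableP _ (rp _)) : hi => hi.
apply/filt_measurableP => //; apply: measurable_fun_ifT => //.
  by apply: measurable_fun_ler.
apply: measurable_funD => //; apply: measurable_funB => //.
exact: measurable_funM.
Qed.

Lemma expectation_stopped (c r : nat -> R) (lam : R) (n : nat) :
  0 <= r 0%N -> {homo r : m n / (m <= n)%N >-> m <= n} ->
  (\int[P]_w (expR (stopped c r lam n w))%:E = 1)%E.
Proof.
move=> r0 rh; have rp m : 0 <= r m by exact: le_trans r0 (rh _ _ _).
elim: n => [|n IH] /=.
  by under eq_integral do rewrite expR0; rewrite integral_cst//= probability_setT mule1.
have hX := @filt_measurable_stopped c r lam n r0 rh.
have mX := filt_measurable_fun (rp n) hX.
set X := stopped c r lam n in IH hX mX *.
pose g1 x := if lam <= x then expR x else 0.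
pose g2 x := if lam <= x then 0 else expR x.
have mg1 : measurable_fun setT g1.
  by apply: measurable_fun_ifT => //; exact: measurable_fun_ler.
have mg2 : measurable_fun setT g2.
  by apply: measurable_fun_ifT => //; exact: measurable_fun_ler.
have g10 x : 0 <= g1 x by rewrite /g1; case: ifP => // _; exact: expR_ge0.
have g20 x : 0 <= g2 x by rewrite /g2; case: ifP => // _; exact: expR_ge0.
have mI : measurable_fun [set: T] (increment B (r n) (r n.+1)).
  exact: measurable_increment.
pose k := expR (c n ^+ 2 * (r n.+1 - r n) / 2).
have k0 : 0 < k by exact: expR_gt0.
transitivity (\int[P]_w ((g1 (X w))%:E +
    (g2 (X w) * expR (c n * increment B (r n) (r n.+1) w))%:E * k^-1%:E)%E)%E.
  apply: eq_integral => w _; rewrite /g1 /g2.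
  case: ifP => _; first by rewrite mul0r mul0e adde0.
  by rewrite add0e -EFinM; congr EFin; rewrite !expRD expRN mulrA.
have mgI : measurable_fun [set: T] (fun w =>
    (g2 (X w) * expR (c n * increment B (r n) (r n.+1) w))%:E).
  apply/measurable_EFinP; apply: measurable_funM; first exact: measurableT_comp.
  by apply: measurableT_comp => //; exact: measurable_funM.
have mg1X : measurable_fun [set: T] (fun w => (g1 (X w))%:E).
  by apply/measurable_EFinP; exact: measurableT_comp.
have mg2X : measurable_fun [set: T] (fun w => (g2 (X w))%:E).
  by apply/measurable_EFinP; exact: measurableT_comp.
rewrite ge0_integralD//; first last.
- exact: emeasurable_funM.
- move=> w _; apply: mule_ge0; rewrite lee_fin; last by rewrite invr_ge0 ltW.
  by rewrite mulr_ge0// expR_ge0.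
- by move=> w _; rewrite lee_fin.
rewrite ge0_integralZr//; first last.
- by rewrite lee_fin invr_ge0 ltW.
- by move=> w _; rewrite lee_fin mulr_ge0// expR_ge0.
rewrite expectation_increment//; last exact: rh.
rewrite -muleA -EFinM divff ?gt_eqF// mule1 -ge0_integralD//; first last.
- by move=> w _; rewrite lee_fin.
- by move=> w _; rewrite lee_fin.
rewrite -[RHS]IH; apply: eq_integral => w _; rewrite /g1 /g2 -EFinD; congr EFin.
by case: ifP => _; rewrite ?addr0 ?add0r.
Qed.

Lemma stopped_crossing (c r : nat -> R) (lam : R) (n N : nat) (w : T) :
  (n <= N)%N ->
  lam <= \sum_(i < n) (c i * increment B (r i) (r i.+1) w
                       - c i ^+ 2 * (r i.+1 - r i) / 2) ->
  lam <= stopped c r lam N w.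
Proof.
move=> nN h.
have stay m : lam <= stopped c r lam m w -> lam <= stopped c r lam m.+1 w.
  by move=> hm; rewrite /= hm.
have stays m p : (m <= p)%N -> lam <= stopped c r lam m w -> lam <= stopped c r lam p w.
  by move=> /subnKC <-; elim: (p - m)%N => [|q IH]; rewrite ?addn0// addnS => /IH/stay.
apply: (stays _ _ nN).
(* Until it first reaches [lam], the stopped sum coincides with the unstopped one; afterwards it
   stays frozen above [lam]. *)
suff [//|->//] : lam <= stopped c r lam n w \/ stopped c r lam n w =
   \sum_(i < n) (c i * increment B (r i) (r i.+1) w - c i ^+ 2 * (r i.+1 - r i) / 2).
elim: n {h nN} => [|n [IH|IH]]; first by right; rewrite big_ord0.
  by left; exact: stay.
have [hn|hn] := boolP (lam <= stopped c r lam n w); first by left; exact: stay.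
by right; rewrite big_ord_recr /= (negbTE hn) IH.
Qed.

Lemma exp_maximal_inequality (c r : nat -> R) (lam : R) (N : nat) :
  0 <= r 0%N -> {homo r : m n / (m <= n)%N >-> m <= n} ->
  (P [set w | exists2 n, (n <= N)%N &
     (lam <= \sum_(i < n) (c i * increment B (r i) (r i.+1) w
                           - c i ^+ 2 * (r i.+1 - r i) / 2))%R]
   <= (expR (- lam))%:E)%E.
Proof.
move=> r0 rh; have rp m : 0 <= r m by exact: le_trans r0 (rh _ _ _).
have hX := @filt_measurable_stopped c r lam N r0 rh.
have mX := filt_measurable_fun (rp N) hX.
set A := [set w | _].
have mA : measurable A.
  apply: fin_bigcup_measurable; first exact: (finite_II N.+1).
  move=> n _; apply: measurable_ge_set; apply: measurable_sum => i.
  apply: measurable_funB => //; apply: measurable_funM => //.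
  exact: measurable_increment.
rewrite -(@lee_pmul2l _ (expR lam)%:E)// ?lte_fin ?expR_gt0//.
rewrite -EFinM -expRD subrr expR0 -(expectation_stopped c lam N r0 rh).
apply: (@le_trans _ _ (\int[P]_(w in A) (expR lam)%:E)%E).
  by rewrite integral_cst.
have mE : measurable_fun [set: T] (fun w => (expR (stopped c r lam N w))%:E).
  by apply/measurable_EFinP; exact: measurableT_comp.
apply: (@le_trans _ _ (\int[P]_(w in A) (expR (stopped c r lam N w))%:E)%E).
  apply: ge0_le_integral => //.
  - exact: measurable_funTS.
  - by move=> w [n nN h]; rewrite lee_fin ler_expR; exact: stopped_crossing h.
exact: ge0_subset_integral.
Qed.

(* The exponential inequality for the coefficients +- (lam / v) c, the optimal
   choice of the exponent. *)
Lemma maximal_inequality (c r : nat -> R) (N : nat) (v lam : R) :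
  0 <= r 0%N -> {homo r : m n / (m <= n)%N >-> m <= n} ->
  \sum_(i < N) c i ^+ 2 * (r i.+1 - r i) <= v -> 0 < v -> 0 <= lam ->
  (P [set w | exists2 n, (n <= N)%N &
     (lam <= `|\sum_(i < n) c i * increment B (r i) (r i.+1) w|)%R]
   <= (2 * expR (- (lam ^+ 2 / (2 * v))))%:E)%E.
Proof.
move=> r0 rh cv v0 lam0; have rp m : 0 <= r m by exact: le_trans r0 (rh _ _ _).
(* [e] is a sign: the values 1 and -1 account for the two sides of the absolute value, and for the
   factor 2. *)
pose A (e : R) := [set w | exists2 n, (n <= N)%N &
     lam ^+ 2 / (2 * v) <=
     \sum_(i < n) ((e * (lam / v) * c i) * increment B (r i) (r i.+1) w
                     - (e * (lam / v) * c i) ^+ 2 * (r i.+1 - r i) / 2)].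
have PA e : (P (A e) <= (expR (- (lam ^+ 2 / (2 * v))))%:E)%E.
  exact: (@exp_maximal_inequality (fun i => e * (lam / v) * c i) r).
have mA e : measurable (A e).
  apply: fin_bigcup_measurable; first exact: (finite_II N.+1).
  move=> n _; apply: measurable_ge_set; apply: measurable_sum => i.
  apply: measurable_funB => //; apply: measurable_funM => //.
  exact: measurable_increment.
apply: (@le_trans _ _ (P (A 1 `|` A (-1)))); last first.
  apply: (le_trans (measureU2 _ _ _)) => //; rewrite mulr_natl mulr2n EFinD.
  by apply: leeD; exact: PA.
apply: le_measure; rewrite ?inE.
- apply: fin_bigcup_measurable; first exact: (finite_II N.+1).
  move=> n _; apply: measurable_ge_set; apply: measurableT_comp => //.
  apply: measurable_sum => i; apply: measurable_funM => //.
  exact: measurable_increment.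
- exact: measurableU.
move=> w [n nN].
set S := \sum_(i < n) _.
have key (e : R) : e ^+ 2 = 1 -> lam <= e * S -> A e w.
  move=> e1 h; exists n => //.
  pose l := lam / v; pose V := \sum_(i < n) c i ^+ 2 * (r i.+1 - r i).
  rewrite [leRHS](_ : _ = l * (e * S) - l ^+ 2 / 2 * V); last first.
    rewrite /S /V !big_distrr /= -sumrB; apply: eq_bigr => i _.
    by rewrite !exprMn e1 -/l; ring.
  have l0 : 0 <= l by rewrite divr_ge0// ltW.
  have Vv : V <= v.
    apply: le_trans cv.
    rewrite /V -(big_mkord xpredT (fun i => c i ^+ 2 * (r i.+1 - r i))).
    rewrite -[leRHS](big_mkord xpredT (fun i => c i ^+ 2 * (r i.+1 - r i))).
    rewrite (big_cat_nat _ nN)//= lerDl sumr_ge0// => i _.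
    by rewrite mulr_ge0 ?sqr_ge0// subr_ge0 rh.
  (* The threshold is the same expression with [lam] in place of [e * S] and [v] in place of [V], so
     the two can be compared term by term. *)
  rewrite [leLHS](_ : _ = l * lam - l ^+ 2 / 2 * v); last first.
    by rewrite /l; field; rewrite gt_eqF.
  by rewrite lerB// ler_wpM2l// divr_ge0// sqr_ge0.
rewrite ler_normr => /orP[h|h]; [left; apply: key => //|right; apply: key].
- by rewrite expr1n.
- by rewrite mul1r.
- by rewrite sqrrN expr1n.
- by rewrite mulN1r.
Qed.

(* step_int B (stop u s) is the integral over [0, u] of the step function s *)
Definition stop (u : R) (s : seq (R * R * R)) : seq (R * R * R) :=
  [seq (Num.min q.1.1 u, Num.min q.1.2 u, q.2) | q <- s].

Lemma measurable_step_int (t : R) (s : seq (R * R * R)) :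
  step_on t s -> measurable_fun [set: T] (step_int B s).
Proof.
elim: s => [|[[a b] c] s IH] st.
  rewrite (_ : step_int B _ = cst 0)//.
  by apply/funext => w; rewrite /step_int big_nil.
rewrite (_ : step_int B _ =
    fun w => c * increment B a b w + step_int B s w); last first.
  by apply/funext => w; rewrite /step_int big_cons.
have [/andP[a0 ab] bt] := st a b c (mem_head _ _).
apply: measurable_funD; last first.
  by apply: IH => a' b' c' h; apply: (st a' b' c'); rewrite in_cons h orbT.
by apply: measurable_funM => //; apply: measurable_increment => //; exact: le_trans ab.
Qed.

Lemma step_int_stop (t : R) (s : seq (R * R * R)) : step_on t s ->
  step_int B (stop t s) = step_int B s.
Proof.
move=> st; apply/funext => w; rewrite /step_int big_map.
apply: eq_big_seq => -[[a b] c] /st[/andP[a0 ab] bt] /=.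
by rewrite !min_l// (le_trans ab).
Qed.

Lemma step_on_stop (t u : R) (s : seq (R * R * R)) : 0 <= u -> step_on t s ->
  step_on u (stop u s).
Proof.
move=> u0 st a' b' c' /mapP[[[a b] c] /st[/andP[a0 ab] bt] /= [-> -> _]].
split; last by rewrite ge_min lexx orbT.
by rewrite le_min a0 u0/= le_min !ge_min ab lexx orbT.
Qed.

Lemma step_int_cat (s1 s2 : seq (R * R * R)) w :
  step_int B (s1 ++ s2) w = step_int B s1 w + step_int B s2 w.
Proof. exact: big_cat. Qed.

Lemma step_fun_cat (s1 s2 : seq (R * R * R)) x :
  step_fun (s1 ++ s2) x = step_fun s1 x + step_fun s2 x.
Proof. exact: big_cat. Qed.

Lemma measurable_step_fun (s : seq (R * R * R)) :
  measurable_fun [set: R] (step_fun s).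
Proof.
by apply: measurable_sum => q; apply: measurable_funM.
Qed.

(* The jumps of the step function are among the r n, so that it is constant
   between two consecutive ones. *)
Section grid.
Variables (s : seq (R * R * R)) (r : nat -> R).
Hypothesis rh : {homo r : m n / (m <= n)%N >-> m <= n}.
Hypothesis sr : forall a b c, (a, b, c) \in s ->
  [/\ a <= b, exists i, a = r i & exists j, b = r j].

Lemma grid_gap (i n : nat) : r i <= r n \/ r n.+1 <= r i.
Proof. by case: (leqP i n) => h; [left|right]; exact: rh. Qed.

(** The value on each cell is read at its right end point, because the pieces []a, b]] are closed on
    the right. *)
Lemma step_int_grid (n : nat) w :
  step_int B (stop (r n) s) w =
  \sum_(i < n) step_fun s (r i.+1) * increment B (r i) (r i.+1) w.
Proof.
elim: n => [|n IH].
  rewrite big_ord0 /step_int big_map big1_seq// => -[[a b] c] /= /sr.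
  move=> [ab [i ai] [j bj]]; rewrite !min_r ?ai ?bj ?rh//.
  by rewrite /increment subrr mulr0.
rewrite big_ord_recr /= -{}IH /step_int /step_fun !big_map big_distrl -big_split/=.
apply: eq_big_seq => -[[a b] c] /sr /=[ab [i ai] [j bj]].
rewrite indicE mem_setE in_itv/=.
(* At a repeated grid point the indicator may be 1, but the increment vanishes. *)
have rr : r n = r n.+1 \/ r n < r n.+1.
  by have := rh (leqnSn n); rewrite le_eqVlt => /predU1P.
have := grid_gap i n; have := grid_gap j n; rewrite -ai -bj => b_ a_.
rewrite -mulrA -mulrDr; congr (_ * _); rewrite /increment.
case: rr => [->|rr].
  by rewrite !subrr mulr0 addr0.
case: b_ => hb.
  have ha := le_trans ab hb.
  rewrite !min_l// ?(le_trans hb (ltW rr)) ?(le_trans ha (ltW rr))//.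
  by rewrite (lt_geF (le_lt_trans hb rr)) andbF mul0r addr0.
rewrite [Num.min b (r n)]min_r ?(le_trans (ltW rr))// [Num.min b _]min_r// hb andbT.
case: a_ => ha.
  rewrite !min_l// ?(le_trans ha (ltW rr))// (le_lt_trans ha rr) mul1r.
  by ring.
rewrite !min_r// ?(le_trans (ltW rr))// (le_gtF ha) mul0r.
by rewrite !subrr addr0.
Qed.

Lemma step_fun_grid (n : nat) x : r n < x <= r n.+1 ->
  step_fun s x = step_fun s (r n.+1).
Proof.
move=> /andP[x0 x1]; apply: eq_big_seq => -[[a b] c] /sr /=[ab [i ai] [j bj]].
rewrite !indicE !mem_setE !in_itv/=; congr (_ * (_ && _)%:R).
  have := grid_gap i n; rewrite -ai => -[h|h].
    by rewrite (le_lt_trans h x0) (le_lt_trans h)// (lt_le_trans x0).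
  by rewrite (le_gtF h) (le_gtF (le_trans x1 h)).
have := grid_gap j n; rewrite -bj => -[h|h].
  by rewrite (lt_geF (le_lt_trans h x0)) (lt_geF (le_lt_trans h _))// (lt_le_trans x0).
by rewrite h (le_trans x1 h).
Qed.

Lemma step_sum_grid (n : nat) :
  (\int[leb]_(x in `]r 0%N, r n]) ((step_fun s x) ^+ 2)%:E =
   (\sum_(i < n) step_fun s (r i.+1) ^+ 2 * (r i.+1 - r i))%:E)%E.
Proof.
elim: n => [|n IH].
  by rewrite set_itv_ge ?bnd_simp ?ltxx// integral_set0 big_ord0.
have rr : r n <= r n.+1 by exact: rh.
have m2 : measurable_fun [set: R] (fun x => (step_fun s x ^+ 2)%:E).
  by apply/measurable_EFinP; apply: measurable_funX; exact: measurable_step_fun.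
rewrite (@itv_bndbnd_setU _ _ _ (BRight (r n))) ?bnd_simp//; last by rewrite rh.
rewrite ge0_integral_setU//=; first last.
- rewrite disj_set2E; apply/eqP/seteqP; split => x //=; rewrite !in_itv/=.
  by case=> /andP[_ h] /andP[/lt_geF]; rewrite h.
- by move=> x _; rewrite lee_fin sqr_ge0.
- exact: measurable_funTS.
rewrite IH big_ord_recr /= EFinD; congr (_ + _)%E.
transitivity (\int[leb]_(x in `]r n, r n.+1]) (step_fun s (r n.+1) ^+ 2)%:E)%E.
  apply: eq_integral => x; rewrite inE/= in_itv/= => h.
  by rewrite (step_fun_grid h).
rewrite integral_cst//= lebesgue_measure_itv/= lte_fin.
case: ltP => h; first by rewrite -EFinD -EFinM.
by rewrite (le_anti (_ : r n <= r n.+1 <= r n)) ?rr// subrr mulr0 mule0.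
Qed.
End grid.

(** The jump points of [s] and the observation times [ts] are sorted into one grid. On it the
    stopped integrals are partial sums of the discrete inequality, and the quadratic sum is an
    integral of the squared step function over part of [0, t]. *)
Lemma step_maximal_inequality (s : seq (R * R * R)) (ts : seq R) (t v lam : R) :
  step_on t s -> (forall u, u \in ts -> 0 <= u <= t) ->
  (\int[leb]_(x in `[0%R, t]) ((step_fun s x) ^+ 2)%:E <= v%:E)%E ->
  0 < v -> 0 <= lam ->
  (P [set w | exists2 u, u \in ts & (lam <= `|step_int B (stop u s) w|)%R]
   <= (2 * expR (- (lam ^+ 2 / (2 * v))))%:E)%E.
Proof.
move=> st tst hv v0 lam0; have [ts0|ts0] := eqVneq ts [::].
  rewrite ts0 (_ : [set w | _] = set0) ?measure0 ?lee_fin ?mulr_ge0 ?expR_ge0//.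
  by apply/seteqP; split => w // -[u]; rewrite in_nil.
have t0 : 0 <= t.
  move: ts0 tst; case: (ts) => // u0 ts' _ /(_ u0 (mem_head _ _))/andP[h1 h2].
  exact: le_trans h2.
pose e := sort <=%R ([seq q.1.1 | q <- s] ++ [seq q.1.2 | q <- s] ++ ts).
(* The default value [t] keeps [r] nondecreasing beyond the end of the list, as no entry of [e]
   exceeds [t]. *)
pose r n := nth t e n.
have et x : x \in e -> 0 <= x <= t.
  rewrite mem_sort !mem_cat => /or3P[/mapP[[[a b] c] /st[/andP[a0 ab] bt] ->]|
    /mapP[[[a b] c] /st[/andP[a0 ab] bt] ->]|/tst//] /=.
  - by rewrite a0 (le_trans ab).
  - by rewrite (le_trans a0).
have er x : x \in e -> exists2 n, (n <= size e)%N & x = r n.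
  move=> xe; exists (index x e); last by rewrite /r nth_index.
  exact: index_size.
have rh : {homo r : m n / (m <= n)%N >-> m <= n}.
  move=> m n mn; rewrite /r; have [ne|ne] := ltnP n (size e); last first.
    rewrite [leRHS]nth_default//; have [me|me] := ltnP m (size e).
      by have /andP[] := et _ (mem_nth t me).
    by rewrite nth_default.
  apply: (sorted_leq_nth le_trans lexx) => //; rewrite ?inE//.
    by apply: sort_sorted; exact: le_total.
  exact: leq_ltn_trans ne.
have rt n : 0 <= r n <= t.
  have [ne|ne] := ltnP n (size e); first exact: et (mem_nth t ne).
  by rewrite /r nth_default// t0 lexx.
have sr a b c : (a, b, c) \in s ->
    [/\ a <= b, exists i, a = r i & exists j, b = r j].
  move=> qs; have [/andP[_ ab] _] := st a b c qs; split => //.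
    have [|n _ ->] := er a; last by exists n.
    by rewrite mem_sort !mem_cat (map_f (fun q => q.1.1) qs).
  have [|n _ ->] := er b; last by exists n.
  by rewrite mem_sort !mem_cat (map_f (fun q => q.1.2) qs) orbT.
have mS u : 0 <= u -> measurable_fun [set: T] (fun w => `|step_int B (stop u s) w|).
  move=> u_ge0; apply: measurableT_comp => //.
  exact: measurable_step_int (step_on_stop u_ge0 st).
have cv : \sum_(i < size e) step_fun s (r i.+1) ^+ 2 * (r i.+1 - r i) <= v.
  rewrite -lee_fin -step_sum_grid//; apply: le_trans hv.
  apply: ge0_subset_integral => //.
  - apply/measurable_EFinP; apply: measurable_funX; apply: measurable_funTS.
    exact: measurable_step_fun.
  - by move=> x _; rewrite lee_fin sqr_ge0.
  - by apply: subset_itv; rewrite bnd_simp;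
      have /andP[] := rt 0%N; have /andP[] := rt (size e).
have r0 : 0 <= r 0%N by have /andP[] := rt 0%N.
apply: le_trans (@maximal_inequality (fun i => step_fun s (r i.+1)) r _ _ _
  r0 rh cv v0 lam0).
apply: le_measure; rewrite ?inE.
- apply: fin_bigcup_measurable; first exact: finite_seq.
  by move=> u /tst/andP[u_ge0 _]; apply: measurable_ge_set; exact: mS.
- apply: fin_bigcup_measurable; first exact: (finite_II (size e).+1).
  move=> n _; apply: measurable_ge_set; apply: measurableT_comp => //.
  apply: measurable_sum => i; apply: measurable_funM => //.
  by apply: measurable_increment; [have /andP[] := rt i | have /andP[] := rt i.+1].
move=> w [u uts h].
have [|n nN un] := er u; first by rewrite mem_sort !mem_cat uts !orbT.
by exists n => //; move: h; rewrite un (step_int_grid rh sr).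
Qed.

End brownian.

(** * Maximal inequality for the Ito integral *)

Section ito.
Context {R : realType} {d : measure_display} {T : measurableType d}.
Variable P : probability T R.
Variable filt : R -> set (set T).
Hypothesis hfilt : usual_conditions P filt.
Variable B : R -> T -> R.
Hypothesis hB : brownian_motion P filt B.
Variable sigma : R -> R.
Hypothesis msigma : forall t : R, measurable_fun `[0, t] sigma.
Local Notation leb := (@lebesgue_measure R).

Lemma second_moment_tail (Y : T -> R) (eta lam : R) :
  measurable_fun [set: T] Y -> 0 < lam ->
  (\int[P]_w ((Y w) ^+ 2)%:E <= eta%:E)%E ->
  (P [set w | (lam <= `|Y w|)%R] <= (eta / lam ^+ 2)%:E)%E.
Proof.
move=> mY lam0 hY; set A := [set w | _].
have mA : measurable A by apply: measurable_ge_set; exact: measurableT_comp.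
have l20 : 0 < lam ^+ 2 by rewrite exprn_gt0.
have mY2 : measurable_fun [set: T] (fun w => (Y w ^+ 2)%:E).
  by apply/measurable_EFinP; exact: measurable_funX.
rewrite -(@lee_pmul2l _ (lam ^+ 2)%:E)// -EFinM mulrC divfK ?gt_eqF//.
apply: le_trans hY; apply: (@le_trans _ _ (\int[P]_(w in A) (lam ^+ 2)%:E)%E).
  by rewrite integral_cst.
apply: (@le_trans _ _ (\int[P]_(w in A) (Y w ^+ 2)%:E)%E).
  apply: ge0_le_integral => //.
  - by move=> w _; rewrite lee_fin sqr_ge0.
  - exact: measurable_funTS.
  - move=> w Aw; rewrite lee_fin -[leRHS]real_normK ?num_real//.
    by rewrite lerXn2r// ?nnegrE// ltW.
by apply: ge0_subset_integral => // w _; rewrite lee_fin sqr_ge0.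
Qed.

Lemma integral_sqr_triangle (t a b : R) (f g h : R -> R) :
  measurable_fun `[0, t] f -> measurable_fun `[0, t] g -> measurable_fun `[0, t] h ->
  (\int[leb]_(x in `[0%R, t]) ((f x - g x) ^+ 2)%:E <= a%:E)%E ->
  (\int[leb]_(x in `[0%R, t]) ((g x - h x) ^+ 2)%:E <= b%:E)%E ->
  (\int[leb]_(x in `[0%R, t]) ((f x - h x) ^+ 2)%:E <= (2 * a + 2 * b)%:E)%E.
Proof.
move=> mf mg mh ha hb.
have m2 (k l : R -> R) : measurable_fun `[0, t] k -> measurable_fun `[0, t] l ->
    measurable_fun `[0, t] (fun x => ((k x - l x) ^+ 2)%:E).
  by move=> mk ml; apply/measurable_EFinP/measurable_funX; exact: measurable_funB.
apply: (@le_trans _ _ (\int[leb]_(x in `[0%R, t])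
   (2%:E * ((f x - g x) ^+ 2)%:E + 2%:E * ((g x - h x) ^+ 2)%:E))%E).
  apply: ge0_le_integral => //.
  - by move=> x _; rewrite lee_fin sqr_ge0.
  - exact: m2.
  - by apply: emeasurable_funD; apply: emeasurable_funM => //; exact: m2.
  - move=> x _; rewrite -!EFinM -EFinD lee_fin -subr_ge0.
    (* With p = f - g and q = g - h this is 2 p^2 + 2 q^2 - (p + q)^2 = (p - q)^2. *)
    rewrite (_ : _ - _ = (f x - g x - (g x - h x)) ^+ 2) ?sqr_ge0//.
    by ring.
rewrite ge0_integralD//; first last.
- by apply: emeasurable_funM => //; exact: m2.
- by move=> x _; rewrite mule_ge0// lee_fin sqr_ge0.
- by apply: emeasurable_funM => //; exact: m2.
- by move=> x _; rewrite mule_ge0// lee_fin sqr_ge0.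
rewrite !ge0_integralZl//; [|exact: m2|by move=> x _; rewrite lee_fin sqr_ge0|
  exact: m2|by move=> x _; rewrite lee_fin sqr_ge0].
rewrite [leRHS]EFinD [X in (_ <= X + _)%E]EFinM [X in (_ <= _ + X)%E]EFinM.
by apply: leeD; rewrite lee_pmul2l.
Qed.

(** Concatenation with [step_opp] subtracts, so the difference of two step functions is again given
    by a list of triples. *)
Definition step_opp (s : seq (R * R * R)) : seq (R * R * R) :=
  [seq (q.1.1, q.1.2, - q.2) | q <- s].

Lemma step_fun_opp s x : step_fun (step_opp s) x = - step_fun s x.
Proof.
by rewrite /step_fun big_map -sumrN; apply: eq_bigr => q _; rewrite mulNr.
Qed.

Lemma step_int_opp s w : step_int B (step_opp s) w = - step_int B s w.
Proof.
by rewrite /step_int big_map -sumrN; apply: eq_bigr => q _; rewrite mulNr.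
Qed.

Lemma step_fun_stop (u : R) s x : x <= u -> step_fun (stop u s) x = step_fun s x.
Proof.
move=> xu; rewrite /step_fun big_map; apply: eq_bigr => -[[a b] c] _ /=.
rewrite !indicE !mem_setE !in_itv/= gt_min (le_gtF xu) orbF.
by rewrite le_min xu andbT.
Qed.

(** This takes the place of the Ito isometry: the maximal inequality is applied to the difference of
    the step functions at the single time [t]. Comparing both with [sigma] bounds its squared L^2
    norm by [4 * eta]. *)
Lemma step_int_close (s1 s2 : seq (R * R * R)) (t eta lam : R) :
  0 <= t -> step_on t s1 -> step_on t s2 -> 0 < eta -> 0 < lam ->
  (\int[leb]_(x in `[0%R, t]) ((sigma x - step_fun s1 x) ^+ 2)%:E <= eta%:E)%E ->
  (\int[leb]_(x in `[0%R, t]) ((sigma x - step_fun s2 x) ^+ 2)%:E <= eta%:E)%E ->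
  (P [set w | (lam <= `|step_int B s1 w - step_int B s2 w|)%R]
   <= (2 * expR (- (lam ^+ 2 / (2 * (4 * eta)))))%:E)%E.
Proof.
move=> t0 st1 st2 eta0 lam0 h1 h2.
have ms s : measurable_fun `[0, t] (step_fun s).
  by apply: measurable_funTS; exact: measurable_step_fun.
pose s := s1 ++ step_opp s2.
have st : step_on t s.
  move=> a b c; rewrite mem_cat => /orP[/st1//|/mapP[[[a' b'] c']]].
  by move=> /st2 /= + [-> -> _].
rewrite (_ : [set w | _] = [set w | exists2 u, u \in [:: t] &
    lam <= `|step_int B (stop u s) w|]); last first.
  have E w : step_int B s w = step_int B s1 w - step_int B s2 w.
    by rewrite step_int_cat step_int_opp.
  apply/seteqP; split => w /=; rewrite -E.
    by exists t; [exact: mem_head|rewrite (step_int_stop B st)].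
  by move=> [u]; rewrite mem_seq1 => /eqP ->; rewrite (step_int_stop B st).
apply: (step_maximal_inequality hfilt hB st) => //; last exact: ltW.
- by move=> u; rewrite mem_seq1 => /eqP ->; rewrite t0 lexx.
- rewrite (_ : 4 * eta = 2 * eta + 2 * eta); last by ring.
  under eq_integral do rewrite step_fun_cat step_fun_opp.
  apply: (@integral_sqr_triangle t eta eta _ sigma) => //.
  by under eq_integral do rewrite -sqrrN opprB.
- by rewrite mulr_gt0.
Qed.

Lemma ito_approx (t eta : R) (Y : T -> R) : 0 < eta ->
  is_ito_integral P B sigma t Y ->
  exists s, [/\ step_on t s,
    (\int[leb]_(x in `[0%R, t]) ((sigma x - step_fun s x) ^+ 2)%:E <= eta%:E)%E &
    (\int[P]_w ((Y w - step_int B s w) ^+ 2)%:E <= eta%:E)%E].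
Proof.
move=> eta0 [mY [s [st h1 h2]]].
have eventually_le (u : nat -> \bar R) : (u k @[k --> \oo] --> 0)%E ->
    \forall k \near \oo, (u k <= eta%:E)%E.
  move=> /fine_cvgP[fu /cvgrPdist_le/(_ _ eta0)]; move: fu.
  apply: filterS2 => k uk; rewrite sub0r normrN => h.
  rewrite -(fineK uk) lee_fin; exact: le_trans (ler_norm _) h.
have [k [hk1 hk2]] : exists k,
   (\int[leb]_(x in `[0%R, t]) ((sigma x - step_fun (s k) x) ^+ 2)%:E <= eta%:E)%E /\
   (\int[P]_w ((Y w - step_int B (s k) w) ^+ 2)%:E <= eta%:E)%E.
  have h : \forall k \near \oo,
   (\int[leb]_(x in `[0%R, t]) ((sigma x - step_fun (s k) x) ^+ 2)%:E <= eta%:E)%E /\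
   (\int[P]_w ((Y w - step_int B (s k) w) ^+ 2)%:E <= eta%:E)%E.
    by near do split; [exact: eventually_le|exact: eventually_le].
  by near \oo => k; exists k; near: k.
by exists (s k).
Unshelve. all: by end_near. Qed.

Lemma expRN_le_inv (x : R) : 0 < x -> expR (- x) <= x^-1.
Proof.
move=> x0; rewrite expRN lef_pV2 ?posrE ?expR_gt0//.
by rewrite (le_trans _ (expR_ge1Dx x))// lerDr.
Qed.

(* The step functions approximating sigma on [0, u] and on [0, t] are unrelated;
   by the maximal inequality applied to their difference, those of [0, t] stopped
   at u may replace those of [0, u]. *)
Lemma ito_step_close (I : R -> T -> R) (s : seq (R * R * R)) (t u eta lam : R) :
  0 <= u -> u <= t -> is_ito_integral P B sigma u (I u) ->
  step_on t s -> 0 < eta -> 0 < lam ->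
  (\int[leb]_(x in `[0%R, t]) ((sigma x - step_fun s x) ^+ 2)%:E <= eta%:E)%E ->
  (P [set w | (2 * lam <= `|I u w - step_int B (stop u s) w|)%R]
   <= (17 * eta / lam ^+ 2)%:E)%E.
Proof.
move=> u0 ut hI st eta0 lam0 hs.
have [s1 [st1 h1 h2]] := ito_approx eta0 hI.
have mI : measurable_fun [set: T] (I u) by case: hI.
have ms1 := measurable_step_int hfilt hB st1.
have ss := step_on_stop u0 st.
have mss := measurable_step_int hfilt hB ss.
have h3 : (\int[leb]_(x in `[0%R, u])
    ((sigma x - step_fun (stop u s) x) ^+ 2)%:E <= eta%:E)%E.
  have -> : (\int[leb]_(x in `[0%R, u]) ((sigma x - step_fun (stop u s) x) ^+ 2)%:E
      = \int[leb]_(x in `[0%R, u]) ((sigma x - step_fun s x) ^+ 2)%:E)%E.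
    apply: eq_integral => x; rewrite inE/= in_itv/= => /andP[_ xu].
    by rewrite step_fun_stop.
  apply: le_trans hs.
  apply: ge0_subset_integral => //.
  - apply/measurable_EFinP/measurable_funX/measurable_funB; first exact: msigma.
    by apply: measurable_funTS; exact: measurable_step_fun.
  - by move=> x _; rewrite lee_fin sqr_ge0.
  - by apply: subset_itv; rewrite bnd_simp.
pose A1 := [set w | lam <= `|I u w - step_int B s1 w|].
pose A2 := [set w | lam <= `|step_int B s1 w - step_int B (stop u s) w|].
have mA1 : measurable A1.
  by apply: measurable_ge_set; apply: measurableT_comp => //; exact: measurable_funB.
have mA2 : measurable A2.
  by apply: measurable_ge_set; apply: measurableT_comp => //; exact: measurable_funB.
apply: (@le_trans _ _ (P (A1 `|` A2))).
  apply: le_measure; rewrite ?inE.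
  - by apply: measurable_ge_set; apply: measurableT_comp => //; exact: measurable_funB.
  - exact: measurableU.
  move=> w /= h; have [h1'|h1'] := leP lam `|I u w - step_int B s1 w|; [by left|right].
  rewrite /A2/= -(lerD2l lam) -mulr2n -mulr_natl (le_trans h)//.
  rewrite (le_trans (ler_distD (step_int B s1 w) _ _))//.
  by rewrite lerD2r ltW.
apply: (le_trans (measureU2 _ _ _)) => //.
have l20 : 0 < lam ^+ 2 by rewrite exprn_gt0.
(* 17 = 1 + 2 * 8: Chebyshev's inequality contributes 1, and the Gaussian bound 2 exp(- lam^2 / (8
   eta)) is at most 2 * 8 eta / lam^2. *)
rewrite (_ : 17 * eta / _ = eta / lam ^+ 2 + 2 * (8 * eta / lam ^+ 2)); last first.
  by field; rewrite gt_eqF.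
rewrite EFinD; apply: leeD.
  by apply: second_moment_tail => //; exact: measurable_funB.
apply: (le_trans (step_int_close u0 st1 ss eta0 lam0 h1 h3)).
rewrite lee_fin ler_wpM2l//.
rewrite (_ : 8 * eta / _ = (lam ^+ 2 / (2 * (4 * eta)))^-1); last first.
  by field; rewrite !gt_eqF.
by apply: expRN_le_inv; rewrite divr_gt0// !mulr_gt0.
Qed.

(** One step function, approximating [sigma] up to the latest time of [ts], serves all times. Of the
    level [3 * lam], one [lam] goes to its stopped integrals and two to the approximation errors,
    whose total probability is below any [e]. The step function has squared norm at most [3 * v],
    whence [6 * v] in the exponent. *)
Lemma ito_maximal_inequality (I : R -> T -> R) (ts : seq R) (v lam : R) :
  (forall u, u \in ts -> 0 <= u /\ is_ito_integral P B sigma u (I u) /\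
    (\int[leb]_(x in `[0%R, u]) (sigma x ^+ 2)%:E <= v%:E)%E) ->
  0 < v -> 0 < lam ->
  (P [set w | exists2 u, u \in ts & (3 * lam <= `|I u w|)%R]
   <= (2 * expR (- (lam ^+ 2 / (6 * v))))%:E)%E.
Proof.
move=> hts v0 lam0; have [ts0|ts0] := eqVneq ts [::].
  rewrite ts0 (_ : [set w | _] = set0) ?measure0 ?lee_fin ?mulr_ge0 ?expR_ge0//.
  by apply/seteqP; split => w // -[u]; rewrite in_nil.
have [t tts tmax] : exists2 t, t \in ts & forall u, u \in ts -> u <= t.
  elim: ts ts0 {hts} => [//|x s IH] _; have [->|/IH[t tts tm]] := eqVneq s [::].
    by exists x; rewrite ?mem_head// => u; rewrite mem_seq1 => /eqP ->.
  exists (Num.max x t).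
    by rewrite /Num.max; case: ifP => _; rewrite inE ?tts ?eqxx ?orbT.
  move=> u; rewrite inE le_max => /predU1P[->|/tm ->]; rewrite ?lexx ?orbT//.
have [t0 [hIt hvt]] := hts _ tts.
have l20 : 0 < lam ^+ 2 by rewrite exprn_gt0.
have mI u : u \in ts -> measurable_fun [set: T] (I u).
  by move=> /hts[_ [[]]].
apply/lee_addgt0Pr => e e0.
pose N := (size ts)%:R : R.
have N0 : 0 < N + 1 by rewrite ltr_wpDl.
(* The first bound gives 2 (v / 2) + 2 v = 3 v for the squared norm of the step function; the second
   makes each error event at most e / (N + 1). *)
pose eta := Num.min (v / 2) (e * lam ^+ 2 / (17 * (N + 1))).
have eta0 : 0 < eta by rewrite lt_min !divr_gt0// ?mulr_gt0.
have [s [st hs _]] := ito_approx eta0 hIt.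
pose A := [set w | exists2 u, u \in ts & lam <= `|step_int B (stop u s) w|].
pose E u := [set w | 2 * lam <= `|I u w - step_int B (stop u s) w|].
have PE u : u \in ts -> (P (E u) <= (e / (N + 1))%:E)%E.
  move=> uts; have [u0 [hIu _]] := hts _ uts.
  apply: (le_trans (ito_step_close u0 (tmax _ uts) hIu st eta0 lam0 hs)).
  rewrite lee_fin ler_pdivrMr// mulrAC -ler_pdivlMl//.
  rewrite (@le_trans _ _ (e * lam ^+ 2 / (17 * (N + 1))))//.
    by rewrite ge_min lexx orbT.
  by rewrite le_eqVlt; apply/orP; left; apply/eqP; field; rewrite gt_eqF.
have mSI u : u \in ts -> measurable_fun [set: T] (step_int B (stop u s)).
  move=> uts; have [u0 _] := hts _ uts.
  exact: (measurable_step_int hfilt hB (step_on_stop u0 st)).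
have mE u : u \in ts -> measurable (E u).
  move=> uts; apply: measurable_ge_set; apply: measurableT_comp => //.
  by apply: measurable_funB; [exact: mI|exact: mSI].
have mA : measurable A.
  apply: fin_bigcup_measurable; first exact: finite_seq.
  by move=> u uts; apply: measurable_ge_set; apply: measurableT_comp => //; exact: mSI.
(* The guard makes every member measurable, so that the later induction may run over arbitrary
   lists. *)
pose EE := \big[setU/set0]_(u <- ts) (if u \in ts then E u else set0).
have mEE : measurable EE.
  by apply: bigsetU_measurable => u _; case: ifPn => // uts; exact: mE.
apply: (@le_trans _ _ (P (A `|` EE))).
  apply: le_measure; rewrite ?inE.
  - apply: fin_bigcup_measurable; first exact: finite_seq.
    by move=> u uts; apply: measurable_ge_set; apply: measurableT_comp => //; exact: mI.
  - exact: measurableU.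
  move=> w [u uts h].
  have [h1|h1] := leP lam `|step_int B (stop u s) w|; first by left; exists u.
  right; rewrite /EE -bigcup_seq; exists u => //=; rewrite uts /E /=.
  rewrite -(lerD2r lam) (_ : 2 * lam + lam = 3 * lam); last by ring.
  rewrite (le_trans h)// -[I u w in leLHS](subrK (step_int B (stop u s) w)).
  by rewrite (le_trans (ler_normD _ _))// lerD2l ltW.
apply: (le_trans (measureU2 _ _ _)) => //; apply: leeD.
  rewrite (_ : 6 * v = 2 * (3 * v)); last by ring.
  apply: (step_maximal_inequality hfilt hB st) => //;
    [| |by rewrite mulr_gt0|exact: ltW].
    by move=> u uts; rewrite tmax// andbT; have [] := hts _ uts.
  have -> : (\int[leb]_(x in `[0%R, t]) (step_fun s x ^+ 2)%:E
      = \int[leb]_(x in `[0%R, t]) ((step_fun s x - cst 0 x) ^+ 2)%:E)%E.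
    by apply: eq_integral => x _; rewrite subr0.
  rewrite (_ : 3 * v = 2 * (v / 2) + 2 * v); last by field.
  apply: (@integral_sqr_triangle t (v / 2) v (step_fun s) sigma (cst 0)) => //.
  - by apply: measurable_funTS; exact: measurable_step_fun.
  - under eq_integral do rewrite -sqrrN opprB.
    by apply: (le_trans hs); rewrite lee_fin ge_min lexx.
  - by under eq_integral do rewrite subr0.
apply: (@le_trans _ _ (\sum_(u <- ts) (e / (N + 1))%:E)%E).
  have e1 : (0 <= (e / (N + 1))%:E)%E by rewrite lee_fin divr_ge0// ltW.
  suff : forall ts', (P (\big[setU/set0]_(u <- ts') (if u \in ts then E u else set0))
      <= \sum_(u <- ts') (e / (N + 1))%:E)%E by apply.
  elim=> [|u ts' IH]; first by rewrite !big_nil measure0.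
  have mF u' : measurable (if u' \in ts then E u' else set0).
    by case: ifPn => // uts; exact: mE.
  rewrite !big_cons; apply: (le_trans (measureU2 _ _ _)) => //.
    by apply: bigsetU_measurable => u' _.
  by apply: leeD => //; case: ifPn => [/PE//|_]; rewrite measure0.
rewrite sumEFin lee_fin big_const_seq count_predT iter_addr addr0 -mulr_natr.
by rewrite mulrAC ler_pdivrMr// ler_pM2l// lerDl.
Qed.

End ito.

(** * Law of the iterated logarithm, up to a constant *)

Section iterated_logarithm.
Context {R : realType} {d : measure_display} {T : measurableType d}.
Variable P : probability T R.
Variable filt : R -> set (set T).
Hypothesis hfilt : usual_conditions P filt.
Variable B : R -> T -> R.
Hypothesis hB : brownian_motion P filt B.
Variable sigma : R -> R.
Hypothesis hsigma : {within `[0, +oo[, continuous sigma}.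
Variable I : R -> T -> R.
Hypothesis hI : ito_process P filt B sigma I.
Local Notation leb := (@lebesgue_measure R).
Local Notation V := (variance_int sigma).

(* An enumeration of the nonnegative rational times. *)
Definition nnrat (k : nat) : R :=
  if unpickle k is Some x then ratr `|x : rat| else 0.

Lemma nnrat_ge0 k : 0 <= nnrat k.
Proof. by rewrite /nnrat; case: unpickle => // x; rewrite ler0q. Qed.

Definition exceeds (v lam : R) (k : nat) : set T :=
  if V (nnrat k) <= v then [set w | 3 * lam <= `|I (nnrat k) w|] else set0.

Lemma measurable_exceeds v lam k : measurable (exceeds v lam k).
Proof.
rewrite /exceeds; case: ifP => // _; apply: measurable_ge_set.
by apply: measurableT_comp => //; case: (ip_integral hI (nnrat_ge0 k)).
Qed.

(** The bound for finitely many times does not depend on their number, so it survives the increasing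
    union. *)
Lemma exceeds_bound (v lam : R) : 0 < v -> 0 < lam ->
  (P (\bigcup_k exceeds v lam k) <= (2 * expR (- (lam ^+ 2 / (6 * v))))%:E)%E.
Proof.
move=> v0 lam0; pose U K := \big[setU/set0]_(k < K) exceeds v lam k.
have mU K : measurable (U K).
  by apply: bigsetU_measurable => k _; exact: measurable_exceeds.
have UE : \bigcup_k exceeds v lam k = \bigcup_K U K.
  apply/seteqP; split => w [k _]; last first.
    by rewrite /U -bigcup_mkord => -[j _ h]; exists j.
  by move=> h; exists k.+1 => //; rewrite /U -bigcup_mkord; exists k => /=.
have h_cvg : P (U K) @[K --> \oo] --> P (\bigcup_K U K).
  apply: nondecreasing_cvg_mu => //; first exact: bigcup_measurable.
  by apply/nondecreasing_seqP => n; apply/subsetPset; exact: subset_bigsetU.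
rewrite UE -(cvg_lim _ h_cvg)//; apply: lime_le.
  by apply/cvg_ex; eexists; exact: h_cvg.
apply: nearW => K.
pose ts := [seq u <- [seq nnrat k | k <- iota 0 K] | V u <= v].
apply: le_trans (@ito_maximal_inequality _ _ _ P filt hfilt B hB sigma
  (measurable_sigma hsigma) I ts v lam _ v0 lam0).
  apply: le_measure; rewrite ?inE//.
    apply: fin_bigcup_measurable; first exact: finite_seq.
    move=> u; rewrite /= mem_filter => /andP[_ /mapP[k _ ->]]; apply: measurable_ge_set.
    by apply: measurableT_comp => //; case: (ip_integral hI (nnrat_ge0 k)).
  move=> w; rewrite /U -bigcup_mkord => -[k /= kK]; rewrite /exceeds.
  case: ifP => // Vk h; exists (nnrat k) => //; rewrite mem_filter Vk/=.
  by apply: map_f; rewrite mem_iota.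
move=> u; rewrite mem_filter => /andP[Vu /mapP[k _ uE]]; subst u.
split; first exact: nnrat_ge0.
split; first exact: (ip_integral hI (nnrat_ge0 k)).
by rewrite (variance_intE hsigma) lee_fin.
Qed.

(* Chosen so that 2 exp (- lil_level n ^ 2 / (6 e^n)) = 2 / (n + 2)^2. *)
Definition lil_level (n : nat) : R := Num.sqrt (12 * expR n%:R * ln n.+2%:R).

Lemma ln_nat_gt0 (n : nat) : 0 < ln (n.+2%:R : R).
Proof. by rewrite ln_gt0// ltr1n. Qed.

Lemma lil_level_gt0 n : 0 < lil_level n.
Proof. by rewrite sqrtr_gt0 !mulr_gt0// ?expR_gt0// ln_nat_gt0. Qed.

(** 2 / (n + 2)^2 is weakened to 2 / ((n + 1) (n + 2)), which telescopes; the Borel-Cantelli sum is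
    then explicitly at most 2. *)
Lemma exceeds_level_bound n :
  (P (\bigcup_k exceeds (expR n%:R) (lil_level n) k)
    <= (2 * (n.+1%:R^-1 - n.+2%:R^-1))%:E)%E.
Proof.
apply: le_trans (exceeds_bound (expR_gt0 _) (lil_level_gt0 n)) _.
rewrite lee_fin ler_pM2l//.
have e0 : 0 < expR n%:R :> R by exact: expR_gt0.
rewrite sqr_sqrtr; last by rewrite ltW// !mulr_gt0// ln_nat_gt0.
rewrite (_ : _ / _ = ln n.+2%:R + ln n.+2%:R); last by field; rewrite gt_eqF.
rewrite opprD expRD expRN lnK ?posrE//.
have n1 : n.+1%:R > 0 :> R by [].
have n2 : n.+2%:R > 0 :> R by [].
have -> : n.+1%:R^-1 - n.+2%:R^-1 = n.+1%:R^-1 * n.+2%:R^-1 :> R.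
  have n2E : n.+2%:R = n.+1%:R + 1 :> R by rewrite natr1.
  by rewrite n2E in n2 *; field; rewrite !gt_eqF.
by rewrite ler_pM2r ?invr_gt0// lef_pV2 ?posrE// ler_nat.
Qed.

Lemma ae_exceeds : {ae P, forall w, exists n0, forall n, (n0 <= n)%N ->
  forall k, ~ exceeds (expR n%:R) (lil_level n) k w}.
Proof.
pose E n := \bigcup_k exceeds (expR n%:R) (lil_level n) k.
have mE n : measurable (E n).
  by apply: bigcup_measurable => k _; exact: measurable_exceeds.
have : P (lim_sup_set E) = 0%E.
  apply: lim_sup_set_cvg0 => //.
  apply: (@le_lt_trans _ _ 2%:E); last exact: ltry.
  apply: lime_le; first exact: is_cvg_nneseries.
  apply: nearW => N; apply: (@le_trans _ _
    (\sum_(0 <= n < N) (2 * (n.+1%:R^-1 - n.+2%:R^-1))%:E)%E).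
    by apply: lee_sum => n _; exact: exceeds_level_bound.
  rewrite sumEFin lee_fin -mulr_sumr.
  rewrite (_ : \sum_(0 <= n < N) _ = 1 - N.+1%:R^-1); last first.
    elim: N => [|N IH]; first by rewrite big_nil invr1 subrr.
    by rewrite big_nat_recr//= IH subrKA.
  by rewrite ler_piMr// gerBl invr_ge0.
move=> PE; exists (lim_sup_set E); split => //.
  apply: bigcap_measurable => // n _; exact: bigcup_measurable.
move=> w /= h n _; apply: contrapT => h2; apply: h; exists n => m nm k hk.
by apply: h2; exists m => //; exists k.
Qed.

(** By continuity a violation at t > 0 persists at nearby times, in particular at a rational time to
    the left of t, which still lies in the block since V is nondecreasing. The time 0 has no such
    neighbour but is itself rational. *)
Lemma ae_level_bound : {ae P, forall w, exists n0, forall n, (n0 <= n)%N ->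
  forall t, 0 <= t -> V t <= expR n%:R -> `|I t w| <= 3 * lil_level n}.
Proof.
have := ip_continuous hI; rewrite /as_continuous.
apply: filterS2 ae_exceeds => w [n0 h] cI; exists n0 => n nn0 t t0 Vt.
have rat_bound (x : rat) : 0 <= x -> V (ratr x) <= expR n%:R ->
    `|I (ratr x) w| <= 3 * lil_level n.
  move=> x0 Vx; have := h n nn0 (pickle x); rewrite /exceeds /nnrat pickleK.
  by rewrite ger0_norm// Vx => /negP; rewrite -ltNge => /ltW.
move: t0; rewrite le_eqVlt => /predU1P[t0|t0].
  by have := rat_bound 0 (lexx _); rewrite rmorph0 t0; exact.
rewrite leNgt; apply/negP => hI'.
have /= cIt := continuous_within_at cI t0.
have : \forall s \near t, 3 * lil_level n < `|I s w|.
  have : `|I s w| @[s --> t] --> `|I t w| by apply: cvg_norm; exact: cIt.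
  by move=> /cvgr_gt; apply.
move=> /nbhs_ballP[e /= e0 he].
have [x xt] : exists x : rat, Num.max 0 (t - e) < ratr x < t.
  have [|x] := @rat_in_itvoo R (Num.max 0 (t - e)) t.
    by rewrite gt_max t0/= ltrBlDr ltrDl.
  by rewrite in_itv/= => ?; exists x.
have /andP[] := xt; rewrite gt_max => /andP[x0 xe] xt'.
have := rat_bound x; rewrite -(ler0q R) => /(_ (ltW x0)).
have Vx : V (ratr x) <= expR n%:R.
  by apply: le_trans Vt; apply: (le_variance_int hsigma); exact: ltW.
move=> /(_ Vx); rewrite leNgt he//= /ball/= ltr_norml.
by rewrite ltrBrDr ltrBlDr; apply/andP; split; lra.
Qed.

Lemma ae_bounded : {ae P, forall w, forall v, exists C,
  forall t, 0 <= t -> V t <= v -> `|I t w| <= C}.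
Proof.
apply: filterS ae_level_bound => w [n0 h] v.
(* Large enough for v <= n <= exp n. *)
pose n := maxn n0 (Num.truncn `|v|).+1.
exists (3 * lil_level n) => t t0 Vt; apply: h => //; first exact: leq_maxl.
apply: (le_trans Vt); apply: (le_trans (ler_norm v)).
apply: (le_trans (ltW (truncnS_gt _))).
apply: (@le_trans _ _ (n%:R)); first by rewrite ler_nat leq_maxr.
by apply: le_trans (expR_ge1Dx _); rewrite lerDr.
Qed.

(** If m is the integer part of ln V, then t lies in block m + 1, and exp(m + 1) <= e V. Moreover m
    + 3 <= ln V + 3 <= (ln V)^2 once ln V >= 3, so ln(m + 3) <= 2 ln ln V. Hence the squared level
    12 exp(m + 1) ln(m + 3) is at most 12 e Sigma^2. *)
Lemma ae_iterated_logarithm : {ae P, forall w, exists v, forall t,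
  0 <= t -> v <= V t -> `|I t w| <= 3 * Num.sqrt (12 * expR 1) * lil_scale sigma t}.
Proof.
apply: filterS ae_level_bound => w [n0 h].
exists (expR (maxn n0 3)%:R) => t t0 Vt.
have V0 : 0 < V t by exact: lt_le_trans Vt.
have lV : (maxn n0 3)%:R <= ln (V t).
  by rewrite -ler_expR lnK ?posrE.
have lV3 : 3 <= ln (V t).
  by apply: le_trans lV; rewrite ler_nat leq_maxr.
have lV0 : 0 <= ln (V t) by exact: le_trans lV3.
pose m := Num.truncn (ln (V t)).
have /andP[m1 m2] : m%:R <= ln (V t) < m.+1%:R by exact: truncn_itv.
have n0m : (n0 <= m.+1)%N.
  rewrite leqW// /m truncn_ge_nat//; apply: le_trans lV.
  by rewrite ler_nat leq_maxl.
apply: le_trans (h _ n0m t t0 _) _.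
  by rewrite -(@lnK _ (V t)) ?posrE// ler_expR ltW.
rewrite -mulrA ler_pM2l// /lil_level /lil_scale -sqrtrM; last first.
  by rewrite mulr_ge0// expR_ge0.
have lnln : ln m.+3%:R <= 2 * ln (ln (V t)).
  rewrite mulr_natl -lnXn; last by exact: lt_le_trans lV3.
  rewrite ler_ln ?posrE//; last by rewrite exprn_gt0// (lt_le_trans _ lV3).
  apply: (@le_trans _ _ (ln (V t) + 3)); first by rewrite -addn3 natrD lerD2r.
  nra.
rewrite ler_wsqrtr// -!mulrA ler_pM2l// -natr1 expRD [expR m%:R * _]mulrC -!mulrA.
rewrite ler_pM2l ?expR_gt0// [2 * _]mulrCA.
apply: ler_pM => //.
  by rewrite ltW// ln_nat_gt0.
by rewrite -(@lnK _ (V t)) ?posrE// ler_expR.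
Qed.

End iterated_logarithm.

(** * Growth of the solution for a given noise path *)

Section growth.
Context {R : realType}.
Variable f : R -> R.
Hypothesis f_gt0 : forall x, 0 < x -> 0 < f x.
Hypothesis fc : continuous f.
Local Notation leb := (@lebesgue_measure R).

Lemma continuous_comp_within (A : set R) (g h : R -> R) : continuous g ->
  {within A, continuous h} -> {within A, continuous (fun s => g (h s))}.
Proof. by move=> gc hc s; apply: continuous_comp; [exact: hc|exact: gc]. Qed.

Lemma continuous_recip (a : R) : 0 < a ->
  {within `[a, +oo[, continuous (fun x => (f x)^-1)}.
Proof.
move=> a0; apply: continuous_in_subspaceT => x; rewrite inE/= in_itv/= andbT => ax.
by apply: cvgV; [rewrite gt_eqF// f_gt0// (lt_le_trans a0) | exact: fc].
Qed.

Lemma le_integral_recip (a b x y : R) : 0 < a -> a <= x -> y <= b ->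
  \int[leb]_(u in `[x, y]) (f u)^-1 <= \int[leb]_(u in `[a, b]) (f u)^-1.
Proof.
move=> a0 ax yb.
have int1 (c e : R) : 0 < c -> leb.-integrable `[c, e] (EFin \o (fun x => (f x)^-1)).
  by move=> c0; exact: (@continuous_within_integrable R (fun x => (f x)^-1) c c e (lexx c)
      (continuous_recip c0)).
have V0 (c u : R) : 0 < c -> c <= u -> 0 <= (f u)^-1.
  by move=> c0 cu; rewrite invr_ge0 ltW// f_gt0// (lt_le_trans c0).
apply: fine_le.
- by apply: integrable_fin_num => //; apply: int1; exact: lt_le_trans ax.
- by apply: integrable_fin_num => //; exact: int1.
apply: ge0_subset_integral => //.
- by case/integrableP: (int1 a b a0).
- move=> u; rewrite /= in_itv/= => /andP[au _]; rewrite lee_fin.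
  exact: V0 au.
- by apply: subset_itv; rewrite bnd_simp.
Qed.

Lemma le_primitive_recip (x y : R) : 0 < x -> x <= y ->
  primitive_recip f x <= primitive_recip f y.
Proof.
move=> x0 xy; rewrite /primitive_recip.
have int_ge0 (a b : R) : 0 < a -> 0 <= \int[leb]_(u in `[a, b]) (f u)^-1.
  move=> a0; apply: Rintegral_ge0 => u /=; rewrite in_itv/= => /andP[au _].
  by rewrite invr_ge0 ltW// f_gt0// (lt_le_trans a0).
case: ifPn => [x1|]; first by rewrite (le_trans x1 xy) le_integral_recip.
rewrite -ltNge => x1; case: ifPn => [y1|_].
  by apply: (@le_trans _ _ 0); rewrite ?oppr_le0 int_ge0.
by rewrite lerN2 le_integral_recip.
Qed.

Lemma le_Ffun (y z : R) : 0 <= y -> y <= z -> 1 <= z ->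
  (Ffun f y <= (primitive_recip f z)%:E)%E.
Proof.
move=> y0 yz z1; rewrite /Ffun; case: ifPn => [y_gt0|_].
  by rewrite lee_fin le_primitive_recip.
(* For y = 0, monotonicity turns the right limit into an infimum over ]0, 1[, finite or not, which
   the value at 1/2 bounds from above. *)
have h : (primitive_recip f x)%:E @[x --> 0^'+] -->
    ereal_inf ((fun x => (primitive_recip f x)%:E) @` `]0, 1[%classic).
  apply: (@nondecreasing_at_right_cvge R (fun x => (primitive_recip f x)%:E) 0 (BLeft 1)).
    by rewrite bnd_simp.
  move=> u v; rewrite !in_itv/= => /andP[u0 _] _ uv.
  by rewrite lee_fin le_primitive_recip.
rewrite (cvg_lim _ h)//.
apply: (@le_trans _ _ (primitive_recip f 2^-1)%:E).
  apply: ereal_inf_lbound; exists 2^-1 => //=; rewrite in_itv/=.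
  by apply/andP; split; lra.
rewrite lee_fin le_primitive_recip//; lra.
Qed.

Lemma limsup_Ffun_le1 (M : R) (x : R -> R) : 0 < M ->
  (forall e, 0 < e -> exists K, \forall t \near +oo,
     (Ffun f `|x t| <= (K + (1 + e) * M * t)%:E)%E) ->
  (limf_esup (fun t : R => Ffun f `|x t| / (M * t)%:E) (pinfty_nbhs R) <= 1)%E.
Proof.
move=> M0 h; apply/lee_addgt0Pr => e e0.
have e2 : 0 < e / 2 by rewrite divr_gt0.
have [K [A [Ar hK]]] := h _ e2.
(* Half of [e] is spent on the slope; beyond [a] the other half absorbs the constant, as |K| <= (e /
   2) M t. *)
pose a := Num.max A (Num.max 1 (2 * `|K| / (e * M))).
rewrite limf_esupE.
apply: (@le_trans _ _
  (ereal_sup [set (Ffun f `|x t| / (M * t)%:E)%E | t in [set t | a < t]])).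
  apply: ereal_inf_lbound; exists [set t | a < t] => //.
  by exists a; split => //; exact: num_real.
apply: ub_ereal_sup => _ [t /= + <-]; rewrite !gt_max => /and3P[At t1 tK].
have t0 : 0 < t by exact: lt_trans t1.
have Mt : 0 < M * t by exact: mulr_gt0.
rewrite inver gt_eqF// lee_pdivrMr//.
apply: (le_trans (hK _ At)); rewrite -EFinD -EFinM lee_fin.
move: tK; rewrite ltr_pdivrMr ?mulr_gt0// => tK.
have := ler_norm K; nra.
Qed.

Lemma Ffun_growth (g x : R -> R) (K c a t : R) :
  {within `[a, +oo[, continuous g} -> 1 < K -> a <= t ->
  (forall s, a < s -> 0 <= g s <= c * f (K + \int[leb]_(r in `[a, s]) g r)) ->
  `|x t| <= K + \int[leb]_(r in `[a, t]) g r ->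
  (Ffun f `|x t| <= (primitive_recip f K + c * (t - a))%:E)%E.
Proof.
move=> gc K1 at_ hg xt; apply: (@le_trans _ _
    (primitive_recip f (K + \int[leb]_(r in `[a, t]) g r))%:E); last first.
  by rewrite lee_fin; apply: bihari.
apply: le_Ffun => //; apply: ler_wpDr; last exact: ltW.
rewrite -Rintegral_itv_obnd_cbnd; last first.
  apply: integrableS (@continuous_within_integrable _ g a a t (lexx a) gc) => //.
  by apply: subset_itv; rewrite bnd_simp.
by apply: Rintegral_ge0 => r /=; rewrite in_itv/= => /andP[/hg/andP[]].
Qed.

Section volterra.
Variables (M : R) (x noise : R -> R).
Hypothesis M0 : 0 < M.
Hypothesis xc : {within `[0, +oo[, continuous x}.
Hypothesis xle : forall t, 0 <= t ->
  `|x t| <= `|x 0| + M * \int[leb]_(s in `[0, t]) `|f (x s)| + `|noise t|.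
Hypothesis fle : forall e, 0 < e -> exists2 z0, 1 < z0 &
  forall y z, `|y| <= z -> z0 <= z -> `|f y| <= (1 + e) * f z.

Lemma continuous_fx : {within `[0, +oo[, continuous (fun s => `|f (x s)|)}.
Proof.
apply: (@continuous_comp_within _ (fun y => `|f y|)) => // s.
by apply: cvg_norm; exact: fc.
Qed.

Lemma integral_split (g : R -> R) (a b t : R) : {within `[a, +oo[, continuous g} ->
  a <= b -> b <= t ->
  \int[leb]_(s in `[a, t]) g s =
  \int[leb]_(s in `[a, b]) g s + \int[leb]_(s in `[b, t]) g s.
Proof.
move=> gc ab bt.
have it := @continuous_within_integrable _ g a a t (lexx a) gc.
apply/eqP; rewrite addrC -subr_eq; apply/eqP.
rewrite Rintegral_itvB//; rewrite ?bnd_simp//.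
rewrite Rintegral_itv_obnd_cbnd//; apply: integrableS it => //.
by apply: subset_itv; rewrite bnd_simp.
Qed.

Lemma bounded_noise_growth (C : R) : (forall t, 0 <= t -> `|noise t| <= C) ->
  (limf_esup (fun t : R => Ffun f `|x t| / (M * t)%:E) (pinfty_nbhs R) <= 1)%E.
Proof.
move=> hC; apply: limsup_Ffun_le1 => // e e0.
have [z0 z01 hz] := fle e0.
(* Starting from at least [z0] keeps the majorant in the range where [hz] applies. *)
pose K := Num.max z0 (`|x 0| + C).
pose g s := M * `|f (x s)|.
have gc : {within `[0, +oo[, continuous g}.
  by move=> s; apply: cvgM; [exact: cvg_cst | exact: continuous_fx].
have gE t : 0 <= t ->
    \int[leb]_(s in `[0, t]) g s = M * \int[leb]_(s in `[0, t]) `|f (x s)|.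
  move=> t0; rewrite RintegralZl//.
  exact: (@continuous_within_integrable R _ 0 0 t (lexx 0) continuous_fx).
have g_ge0 s : 0 <= g s by rewrite mulr_ge0// ltW.
have Zge s : 0 <= \int[leb]_(r in `[0, s]) g r by apply: Rintegral_ge0 => r _.
have xK t : 0 <= t -> `|x t| <= K + \int[leb]_(s in `[0, t]) g s.
  move=> t0; rewrite gE// (le_trans (xle t0))// addrAC lerD2r.
  by rewrite le_max; apply/orP; right; rewrite lerD2l hC.
have K1 : 1 < K by rewrite lt_max z01.
exists (primitive_recip f K); apply: filterS (nbhs_pinfty_ge (num_real (0 : R))) => t t0.
rewrite (_ : (1 + e) * M * t = (1 + e) * M * (t - 0)); last by rewrite subr0.
apply: (Ffun_growth gc) => //; last exact: xK.
move=> s s0; rewrite g_ge0 mulrAC mulrC ler_pM2l//=; apply: hz.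
  by apply: xK; exact: ltW.
by rewrite ler_wpDr// le_max lexx.
Qed.

(* S plays the role of Sigma; C is arbitrary. *)
Lemma scale_noise_growth (S : R -> R) (C t0 : R) :
  0 <= t0 -> {within `[t0, +oo[, continuous S} -> (forall t, t0 <= t -> 0 <= S t) ->
  (forall t, t0 <= t -> 0 <= f (S t)) ->
  0 < C -> (\forall t \near +oo, `|noise t| <= C * S t) ->
  (forall e, 0 < e -> \forall t \near +oo,
     S t <= e * (M * \int[leb]_(s in `[t0, t]) f (S s))) ->
  (limf_esup (fun t : R => Ffun f `|x t| / (M * t)%:E) (pinfty_nbhs R) <= 1)%E.
Proof.
move=> t00 Sc S0 fS0 C0 hN hS; apply: limsup_Ffun_le1 => // e e0.
(* Then (1 + dl)^2 <= 1 + 3 dl <= 1 + e. *)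
pose dl := Num.min 1 (e / 3).
have dl0 : 0 < dl by rewrite lt_min ltr01 divr_gt0.
have [z0 z01 hz] := fle dl0.
have CC0 : 0 < C + 1 by rewrite ltr_wpDl// ltW.
(* The denominator [C + 1] exceeds both C and 1, so both the noise bound C S and S itself end up
   below dl M J. *)
have [A [Ar hA]] : \forall t \near +oo, `|noise t| <= C * S t /\
    S t <= dl / (C + 1) * (M * \int[leb]_(s in `[t0, t]) f (S s)).
  by apply: filterS2 hN (hS _ (divr_gt0 dl0 CC0)) => t.
pose a := Num.max t0 (A + 1).
have t0a : t0 <= a by rewrite le_max lexx.
have a0 : 0 <= a by exact: le_trans t0a.
have Aa : A < a by rewrite lt_max ltrDl ltr01 orbT.
have fSc : {within `[t0, +oo[, continuous (fun s => f (S s))}.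
  exact: continuous_comp_within.
pose J t := \int[leb]_(s in `[t0, t]) f (S s).
(* All contributions up to time [a], including [J a], are put into K, so that the remaining
   integrals start at [a]. *)
pose K := Num.max z0 (`|x 0| + M * \int[leb]_(s in `[0, a]) `|f (x s)| + dl * M * J a).
pose g s := M * `|f (x s)| + dl * M * f (S s).
have sub0 : `[a, +oo[ `<=` `[0, +oo[ by apply: subset_itv; rewrite bnd_simp.
have subt0 : `[a, +oo[ `<=` `[t0, +oo[ by apply: subset_itv; rewrite bnd_simp.
have fxa : {within `[a, +oo[, continuous (fun s => `|f (x s)|)}.
  exact: continuous_subspaceW sub0 continuous_fx.
have fSa : {within `[a, +oo[, continuous (fun s => f (S s))}.
  exact: continuous_subspaceW subt0 fSc.
have g1c : {within `[a, +oo[, continuous (fun s => M * `|f (x s)|)}.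
  by move=> s; apply: cvgM; [exact: cvg_cst | exact: fxa].
have g2c : {within `[a, +oo[, continuous (fun s => dl * M * f (S s))}.
  by move=> s; apply: cvgM; [exact: cvg_cst | exact: fSa].
have gc : {within `[a, +oo[, continuous g}.
  by move=> s; apply: cvgD; [exact: g1c|exact: g2c].
have gE t : a <= t -> \int[leb]_(s in `[a, t]) g s =
    M * \int[leb]_(s in `[a, t]) `|f (x s)| + dl * M * \int[leb]_(s in `[a, t]) f (S s).
  move=> at_.
  have i1 : leb.-integrable `[a, t] (EFin \o (fun s => `|f (x s)|)).
    exact: (@continuous_within_integrable _ _ a a t (lexx a) fxa).
  have i2 : leb.-integrable `[a, t] (EFin \o (fun s => f (S s))).
    exact: (@continuous_within_integrable _ _ a a t (lexx a) fSa).
  rewrite RintegralD ?RintegralZl//.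
  - exact: (@continuous_within_integrable _ _ a a t (lexx a) g1c).
  - exact: (@continuous_within_integrable _ _ a a t (lexx a) g2c).
have g_ge0 s : a <= s -> 0 <= g s.
  move=> as_; apply: addr_ge0; first by rewrite mulr_ge0// ltW.
  by rewrite mulr_ge0 ?fS0 ?(le_trans t0a)// mulr_ge0// ltW.
have Zge s : 0 <= \int[leb]_(r in `[a, s]) g r.
  by apply: Rintegral_ge0 => r /=; rewrite in_itv/= => /andP[/g_ge0].
have J0 t : 0 <= J t.
  by apply: Rintegral_ge0 => r /=; rewrite in_itv/= => /andP[/fS0].
have ZJ t : a <= t -> dl * M * J t <= K + \int[leb]_(s in `[a, t]) g s.
  move=> at_; rewrite gE// /J (integral_split fSc t0a at_) mulrDr addrA lerD//.
  rewrite -[leLHS]addr0 lerD//.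
    rewrite le_max; apply/orP; right; rewrite lerDr addr_ge0// mulr_ge0 ?(ltW M0)//.
    by apply: Rintegral_ge0.
  by rewrite mulr_ge0 ?(ltW M0)//; apply: Rintegral_ge0.
have SZ t : a <= t -> S t <= K + \int[leb]_(s in `[a, t]) g s.
  move=> at_; apply: le_trans (ZJ _ at_).
  have [_ h] := hA t (lt_le_trans Aa at_).
  apply: (le_trans h); rewrite mulrA; apply: ler_wpM2r; first exact: J0.
  rewrite ler_pM2r// ler_pdivrMr// ler_peMr ?(ltW dl0)//.
  by rewrite lerDr ltW.
have xK t : a <= t -> `|x t| <= K + \int[leb]_(s in `[a, t]) g s.
  move=> at_; rewrite gE//; have tt0 := le_trans a0 at_.
  have [h1 h2] := hA t (lt_le_trans Aa at_).
  have hn : `|noise t| <= dl * M * J t.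
    apply: (le_trans h1); rewrite -ler_pdivlMl//; apply: (le_trans h2).
    rewrite -/(J t) !mulrA ler_wpM2r// ler_pM2r// [_^-1 * _]mulrC ler_pM2l//.
    by rewrite lef_pV2 ?posrE// lerDl.
  apply: (le_trans (xle tt0)); rewrite (integral_split continuous_fx a0 at_).
  have hK : `|x 0| + M * \int[leb]_(s in `[0, a]) `|f (x s)| + dl * M * J a <= K.
    by rewrite le_max lexx orbT.
  move: hn; rewrite /J (integral_split fSc t0a at_) -/(J a) => hn.
  apply: (le_trans (lerD (lexx _) hn)).
  rewrite -(lerD2r (M * \int[leb]_(s in `[a, t]) `|f (x s)| +
    dl * M * \int[leb]_(s in `[a, t]) f (S s))) in hK.
  apply: le_trans hK; rewrite le_eqVlt; apply/orP; left; apply/eqP; ring.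
have K1 : 1 < K by rewrite lt_max z01.
exists (primitive_recip f K); apply: filterS (nbhs_pinfty_ge (num_real a)) => t at_.
apply: (@le_trans _ _ (primitive_recip f K + (1 + dl) * (1 + dl) * M * (t - a))%:E).
  apply: (Ffun_growth gc) => //; last exact: xK.
  move=> s as_; have as' := ltW as_; rewrite g_ge0//=.
  have Z0 : z0 <= K + \int[leb]_(s in `[a, s]) g s.
    by rewrite ler_wpDr// le_max lexx.
  have h1 := hz _ _ (xK s as') Z0.
  have h2 : `|f (S s)| <= (1 + dl) * f (K + \int[leb]_(s in `[a, s]) g s).
    by apply: hz => //; rewrite ger0_norm ?SZ// S0// (le_trans t0a).
  rewrite (_ : (1 + dl) * (1 + dl) * M * _ =
     M * ((1 + dl) * f (K + \int[leb]_(s in `[a, s]) g s)) +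
     dl * M * ((1 + dl) * f (K + \int[leb]_(s in `[a, s]) g s))); last by ring.
  rewrite lerD// ler_pM2l ?mulr_gt0//.
  by apply: le_trans h2; exact: ler_norm.
rewrite lee_fin lerD2l.
have dd : (1 + dl) * (1 + dl) <= 1 + e.
  have d1 : dl <= 1 by rewrite ge_min lexx.
  have d2 : dl <= e / 3 by rewrite ge_min lexx orbT.
  nra.
apply: ler_pM; rewrite ?subr_ge0//.
- by rewrite !mulr_ge0// ?addr_ge0 ?ltW.
- by rewrite ler_pM2r.
- by rewrite gerBl.
Qed.

End volterra.
End growth.

(** * Regularity and asymptotic monotonicity of the nonlinearity *)

Section nonlinearity.
Context {R : realType}.
Implicit Types f phi : R -> R.

Lemma locally_lipschitz_continuous f : locally_lipschitz f -> continuous f.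
Proof.
move=> hf x; have [U Ux lU] := hf x.
have [k k0 hk] : exists2 k : R, 0 < k & forall y z, U y -> U z ->
    `|f y - f z| <= k * `|y - z|.
  have [k k0 hk] := pinfty_ex_gt0 lU.
  by exists k => // y z Uy Uz; exact: (hk (y, z)).
apply/cvgrPdist_le => e e0; near=> y.
have Uy : U y by near: y.
apply: (le_trans (hk _ _ (nbhs_singleton Ux) Uy)).
rewrite -ler_pdivlMl// mulrC; near: y.
have : \forall y \near x, ball x (e / k) y by apply: nbhsx_ballx; exact: divr_gt0.
by apply: filterS => y; rewrite /ball/= => /ltW.
Unshelve. all: by end_near. Qed.

Lemma C1_derive phi dphi (x : R) : is_C1_Rplus phi dphi -> 0 < x ->
  is_derive x 1 phi (dphi x).
Proof.
move=> [_ /(_ x)] + x0 => /(_ (ltW x0)) h.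
have cv : h^-1 *: (phi (h *: 1 + x) - phi x) @[h --> 0^'] --> dphi x.
  apply/cvgrPdist_le => e e0.
  move/cvgrPdist_le : h => /(_ e e0).
  rewrite /within/= /prop_near1 => -[r /= r0 hr].
  (* Increments smaller than x stay in the half-line on which the one-sided difference quotient is
     controlled. *)
  exists (Num.min r x) => /=; first by rewrite lt_min r0.
  move=> k; rewrite /ball_/= sub0r normrN lt_min => /andP[kr kx] k0.
  have E : k *: (1 : R) + x = k + x by rewrite /GRing.scale/= mulr1.
  have := hr (k *: 1 + x); rewrite E /ball_/= opprD addrCA subrr addr0 normrN addrK.
  rewrite [_ *: _]mulrC; apply=> //.
  - by rewrite -subr_eq0 addrK.
  - rewrite in_itv/= andbT.
    by move: kx; rewrite ltr_norml => /andP[? _]; rewrite -lerBlDr sub0r ltW.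
by apply: DeriveDef; [apply/cvg_ex; exists (dphi x) | exact: cvg_lim].
Qed.

Lemma C1_le phi dphi : is_C1_Rplus phi dphi -> (forall x, 0 <= x -> 0 < dphi x) ->
  forall x y, 0 < x -> x <= y -> phi x <= phi y.
Proof.
move=> hphi dphi0 x y x0 xy.
have dv z : x <= z -> is_derive z 1 phi (dphi z).
  by move=> xz; apply: C1_derive => //; exact: lt_le_trans xz.
apply: (@ger0_derive1_le_cc R phi x y) => //; rewrite ?in_itv/= ?lexx ?xy//.
- by move=> z; rewrite in_itv/= => /andP[/ltW/dv[]].
- move=> z; rewrite in_itv/= => /andP[/ltW xz _]; rewrite derive1E.
  by have [_ ->] := dv _ xz; rewrite ltW// dphi0// (le_trans (ltW x0)).
- apply: derivable_within_continuous => z; rewrite in_itv/= => /andP[/dv[]//].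
Qed.

(* This is all that the theorem needs of phi. *)
Lemma asymptotically_monotone f phi dphi : continuous f ->
  is_C1_Rplus phi dphi -> (forall x, 0 <= x -> 0 < phi x) ->
  (forall x, 0 <= x -> 0 < dphi x) -> phi x @[x --> +oo] --> +oo ->
  f x / phi x @[x --> +oo] --> (1 : R) ->
  cvg_at_abs_infty (fun x => `|f x| / phi `|x|) 1 ->
  forall e, 0 < e -> exists2 z0, 1 < z0 &
    forall y z, `|y| <= z -> z0 <= z -> `|f y| <= (1 + e) * f z.
Proof.
move=> fc hphi phi0 dphi0 phioo f1 f2 e e0.
pose dl := Num.min 1 (e / 3).
have dl0 : 0 < dl by rewrite lt_min ltr01 divr_gt0.
have D0 : 0 < 1 + dl by rewrite addr_gt0.
have dle : (1 + dl) * (1 + dl) <= 1 + e.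
  have d1 : dl <= 1 by rewrite ge_min lexx.
  have d2 : dl <= e / 3 by rewrite ge_min lexx orbT.
  nra.
have [A1 [A1r hA1]] : \forall x \near +oo, phi x <= (1 + dl) * f x.
  have dd : 0 < dl / (1 + dl) by exact: divr_gt0.
  move/cvgrPdist_lt : f1 => /(_ _ dd) h.
  apply: filterS2 (nbhs_pinfty_ge (num_real (0 : R))) h => x x0.
  rewrite ltr_norml => /andP[_ h].
  have p0 := phi0 _ x0.
  have : (1 + dl)^-1 < f x / phi x.
    rewrite (_ : (1 + dl)^-1 = 1 - dl / (1 + dl)); last by field; rewrite gt_eqF.
    by rewrite ltrBlDl -ltrBlDr.
  rewrite ltr_pdivlMr// => h'; rewrite -ler_pdivrMl//; exact: ltW.
have [A2 [A2r hA2]] := f2 dl dl0.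
pose x0 := Num.max 1 (A2 + 1).
have x01 : 1 <= x0 by rewrite le_max lexx.
have hx0 y : x0 <= `|y| -> `|f y| <= (1 + dl) * phi `|y|.
  move=> xy; have := hA2 (A2 + 1) _ y; rewrite ltrDl ltr01 => /(_ isT).
  have Ay : A2 + 1 <= `|y| by apply: le_trans xy; rewrite le_max lexx orbT.
  move=> /(_ Ay); rewrite ltr_norml ltrBlDr => /andP[_].
  have p0 := phi0 _ (normr_ge0 y).
  by rewrite ltr_pdivrMr// [dl + 1]addrC => /ltW.
have [C0 hC0] : exists C0, forall y, `|y| <= x0 -> `|f y| <= C0.
  have x00 : - x0 <= x0 by rewrite (ge0_cp (le_trans ler01 x01)).
  have [c _ hc] := @EVT_max R (fun y => `|f y|) _ _ x00
    (continuous_subspaceT (fun y => cvg_norm (fc y))).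
  by exists `|f c| => y yx; apply: hc; rewrite in_itv/= -ler_norml.
have [A3 [A3r hA3]] : \forall x \near +oo, C0 <= phi x by move/cvgryPge : phioo; apply.
pose z0 := Num.max (x0 + 1) (Num.max (A1 + 1) (A3 + 1)).
exists z0; first by rewrite lt_max ltr_pwDr.
move=> y z yz; rewrite !ge_max => /and3P[zx zA1 zA3].
have pz : phi z <= (1 + dl) * f z by apply: hA1; apply: lt_le_trans zA1; rewrite ltrDl.
have fz0 : 0 <= f z.
  have z00 : 0 <= z by rewrite (le_trans _ yz).
  by rewrite -(pmulr_rge0 _ D0) (le_trans _ pz)// ltW// phi0.
apply: (@le_trans _ _ ((1 + dl) * ((1 + dl) * f z))); last first.
  by rewrite mulrA ler_wpM2r.
(* For large |y|, |f y| is at most (1 + dl) phi |y|, and phi is increasing. For small |y|, |f y| is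
   bounded by the compactness constant [C0], which phi z exceeds because phi is unbounded. Either
   way phi z is finally replaced by (1 + dl) f z. *)
have [xy|/ltW xy] := leP x0 `|y|.
  apply: (le_trans (hx0 _ xy)); rewrite ler_pM2l//; apply: le_trans pz.
  by apply: (C1_le hphi) => //; rewrite (lt_le_trans _ xy)// (lt_le_trans _ x01).
apply: (le_trans (hC0 _ xy)); apply: (@le_trans _ _ (phi z)).
  by apply: hA3; apply: lt_le_trans zA3; rewrite ltrDl.
by apply: (le_trans pz); rewrite ler_peMl ?lerDl ?(ltW dl0)// mulr_ge0// ltW.
Qed.

End nonlinearity.

(** * Convolution with mu and the scale Sigma *)

Section convolution.
Context {R : realType}.
Variable mu : {measure set (measurableTypeR R) -> \bar R}.
Hypothesis hmu : (0 < mu `[0%R, +oo[%classic < +oo)%E.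
Local Notation leb := (@lebesgue_measure R).
Local Notation M := (fine (mu `[0, +oo[%classic)).

Lemma total_mass_gt0 : 0 < M.
Proof. exact: fine_gt0. Qed.

Lemma distribution_fin_num (x : R) : mu `[0, x]%classic \is a fin_num.
Proof.
have /andP[_ hoo] := hmu; rewrite ge0_fin_numE//; apply: le_lt_trans hoo.
by apply: le_measure; rewrite ?inE//; apply: subset_itv; rewrite bnd_simp.
Qed.

Lemma distribution_le (x y : R) : x <= y ->
  fine (mu `[0, x]%classic) <= fine (mu `[0, y]%classic).
Proof.
move=> xy; apply: fine_le; rewrite ?distribution_fin_num//.
by apply: le_measure; rewrite ?inE//; apply: subset_itv; rewrite bnd_simp.
Qed.

Lemma distribution_bound (x : R) : 0 <= fine (mu `[0, x]%classic) <= M.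
Proof.
have /andP[h0 hoo] := hmu; rewrite fine_ge0//=; apply: fine_le.
- exact: distribution_fin_num.
- by rewrite ge0_fin_numE.
- by apply: le_measure; rewrite ?inE//; apply: subset_itv; rewrite bnd_simp.
Qed.

Lemma convolution_bound (h : R -> R) (t : R) : {within `[0, +oo[, continuous h} ->
  `|\int[leb]_(s in `[0, t]) (fine (mu `[0, t - s]%classic) * h s)| <=
  M * \int[leb]_(s in `[0, t]) `|h s|.
Proof.
move=> hc.
have ih := @continuous_within_integrable _ h 0 0 t (lexx 0) hc.
have ahc : {within `[0, +oo[, continuous (fun s => `|h s|)}.
  by apply: (@continuous_comp_within R _ (fun y => `|y|)) => //; exact: norm_continuous.
have iah : leb.-integrable `[0, t] (EFin \o (fun s => `|h s|)).
  exact: (@continuous_within_integrable _ _ 0 0 t (lexx 0) ahc).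
have iMh : leb.-integrable `[0, t] (EFin \o (fun s => M * `|h s|)).
  apply: (@continuous_within_integrable _ (fun s => M * `|h s|) 0 0 t (lexx 0)).
  by move=> s; apply: cvgM; [exact: cvg_cst|exact: ahc].
have le s : `|fine (mu `[0, t - s]%classic) * h s| <= M * `|h s|.
  have /andP[h1 h2] := distribution_bound (t - s).
  by rewrite normrM ger0_norm// ler_wpM2r.
have ip : leb.-integrable `[0, t]
    (EFin \o (fun s => fine (mu `[0, t - s]%classic) * h s)).
  apply: le_integrable iMh => //.
    apply/measurable_EFinP; apply: measurable_funM; last first.
      by move/measurable_int : ih => /measurable_EFinP.
    (* The kernel may jump at atoms of [mu]; its measurability comes from monotonicity. *)
    apply: nonincreasing_measurable => // x y xy; apply: distribution_le.
    by rewrite lerD2l lerN2.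
  by move=> s _ /=; rewrite lee_fin (le_trans (le s))// ler_norm.
apply: (le_trans (le_normr_Rintegral _ ip)) => //.
rewrite -RintegralZl//; apply: le_Rintegral => //.
by have := integrable_norm ip; exact.
Qed.

End convolution.

Section scale.
Context {R : realType}.
Variable sigma : R -> R.
Hypothesis hsigma : {within `[0, +oo[, continuous sigma}.
Local Notation leb := (@lebesgue_measure R).
Local Notation V := (variance_int sigma).

Lemma ln_ln_gt0 (v : R) : expR 1 < v -> 0 < ln (ln v).
Proof.
move=> ve; have v0 : 0 < v by apply: lt_trans ve; exact: expR_gt0.
by rewrite ln_gt0// -ltr_expR lnK ?posrE.
Qed.

(** Since V vanishes at 0, this keeps the times considered away from the boundary point, where V has
    no two-sided derivative. *)
Lemma variance_int_gt0 (t : R) : 0 <= t -> expR 1 < V t -> 0 < t.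
Proof.
rewrite le_eqVlt => /predU1P[<-|//].
rewrite /variance_int set_itv1 Rintegral_set1 ltNge.
by rewrite ltW// expR_gt0.
Qed.

Section after.
Variable t0 : R.
Hypothesis t00 : 0 <= t0.
Hypothesis Vt0 : expR 1 < V t0.

Lemma variance_after (t : R) : t0 <= t -> expR 1 < V t.
Proof. by move=> tt; apply: lt_le_trans Vt0 _; exact: le_variance_int. Qed.

Lemma lil_scale_gt0 (t : R) : t0 <= t -> 0 < lil_scale sigma t.
Proof.
move=> /variance_after Vt; rewrite sqrtr_gt0 mulr_gt0 ?ln_ln_gt0// mulr_gt0//.
by rewrite (lt_trans _ Vt)// expR_gt0.
Qed.

Lemma lil_scale_le (t v : R) : t0 <= t -> V t <= v ->
  lil_scale sigma t <= Num.sqrt (2 * v * ln (ln v)).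
Proof.
move=> /variance_after Vt Vv.
have V0 : 0 < V t by rewrite (lt_trans _ Vt)// expR_gt0.
have v0 : 0 < v by exact: lt_le_trans Vv.
have ln1 : 0 < ln (V t) by rewrite ln_gt0// (lt_trans _ Vt)// expR_gt1.
have ln2 : ln (V t) <= ln v by rewrite ler_ln ?posrE.
apply: ler_wsqrtr; apply: ler_pM.
- by rewrite mulr_ge0// ltW.
- by rewrite ltW// ln_ln_gt0.
- by rewrite ler_pM2l.
- by rewrite ler_ln ?posrE// (lt_le_trans ln1).
Qed.

Lemma continuous_lil_scale : {within `[t0, +oo[, continuous (lil_scale sigma)}.
Proof.
apply: continuous_in_subspaceT => t; rewrite inE/= in_itv/= andbT => tt.
have t_gt0 : 0 < t by rewrite (lt_le_trans _ tt)// variance_int_gt0.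
have Vc : {for t, continuous V}.
  apply: differentiable_continuous; apply/derivable1_diffP.
  by have [] := is_derive_integral (continuous_within_sqr hsigma) t_gt0.
have Vt := variance_after tt.
have V0 : 0 < V t by rewrite (lt_trans _ Vt)// expR_gt0.
have lnV0 : 0 < ln (V t) by rewrite ln_gt0// (lt_trans _ Vt)// expR_gt1.
have lnc : ln (V s) @[s --> t] --> ln (V t).
  by apply: continuous_comp; [exact: Vc | exact: continuous_ln].
have lnlnc : ln (ln (V s)) @[s --> t] --> ln (ln (V t)).
  exact: (cvg_comp (fun s => ln (V s)) (@ln R) lnc (continuous_ln lnV0)).
apply: (@cvg_comp _ _ _ (fun s => 2 * V s * ln (ln (V s))) Num.sqrt); last exact: sqrt_continuous.
by apply: cvgM => //; apply: cvgM; [exact: cvg_cst | exact: Vc].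
Qed.

Lemma integral_scale_ge (f : R -> R) (c t : R) : continuous f -> t0 <= t ->
  (forall s, t0 <= s <= t -> c <= f (lil_scale sigma s)) ->
  c * (t - t0) <= \int[leb]_(s in `[t0, t]) f (lil_scale sigma s).
Proof.
move=> fc tt hc.
have fSc : {within `[t0, +oo[, continuous (fun s => f (lil_scale sigma s))}.
  by apply: continuous_comp_within => //; exact: continuous_lil_scale.
have -> : c * (t - t0) = \int[leb]_(s in `[t0, t]) c.
  rewrite Rintegral_cst//= lebesgue_measure_itv/= lte_fin; congr (c * _).
  move: tt; rewrite le_eqVlt => /predU1P[->|->//].
  by rewrite ltxx subrr.
apply: le_Rintegral => //.
- apply: continuous_compact_integrable; first exact: segment_compact.
  by move=> s; exact: cvg_cst.
- exact: (@continuous_within_integrable _ _ t0 t0 t (lexx t0) fSc).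
Qed.

Lemma integral_scale_gt0 (f : R -> R) (t : R) : continuous f ->
  (forall x, 0 < x -> 0 < f x) -> t0 < t ->
  0 < \int[leb]_(s in `[t0, t]) f (lil_scale sigma s).
Proof.
move=> fc f0 tt.
have fSc : {within `[t0, t], continuous (fun s => f (lil_scale sigma s))}.
  apply: continuous_subspaceW (continuous_comp_within fc continuous_lil_scale).
  by apply: subset_itv; rewrite bnd_simp.
have [c] := EVT_min (ltW tt) fSc; rewrite in_itv/= => /andP[tc _] hc.
apply: (@lt_le_trans _ _ (f (lil_scale sigma c) * (t - t0))).
  by rewrite mulr_gt0 ?subr_gt0// f0// lil_scale_gt0.
by apply: integral_scale_ge => //; exact: ltW.
Qed.

(** Bounded variance confines Sigma to a compact interval of positive numbers. There f has a
    positive minimum, so the denominator grows at least linearly while the numerator stays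
    bounded. *)
Lemma Lf_quotient_bounded (f : R -> R) (M v : R) : continuous f ->
  (forall x, 0 < x -> 0 < f x) -> 0 < M -> (forall t, 0 <= t -> V t <= v) ->
  Lf_quotient f sigma M t0 t @[t --> +oo] --> (0 : R).
Proof.
move=> fc f0 M0 Vv.
pose Sm := Num.sqrt (2 * v * ln (ln v)).
have S0 := lil_scale_gt0 (lexx t0).
have SSm t : t0 <= t -> lil_scale sigma t <= Sm.
  by move=> tt; apply: lil_scale_le => //; apply: Vv; exact: le_trans tt.
have [c] := EVT_min (SSm _ (lexx t0)) (continuous_subspaceT fc).
rewrite in_itv/= => /andP[cS _] hc.
have c0 : 0 < f c by rewrite f0// (lt_le_trans S0).
have Sm0 : 0 < Sm by exact: lt_le_trans (SSm _ (lexx t0)).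
apply/cvgrPdist_le => e e0; near=> t.
have tt : t0 < t by near: t; exact: nbhs_pinfty_gt (num_real _).
have te : Sm / (e * (M * f c)) + t0 <= t by near: t; exact: nbhs_pinfty_ge (num_real _).
have hJ : f c * (t - t0) <= \int[leb]_(s in `[t0, t]) f (lil_scale sigma s).
  apply: integral_scale_ge => //.
  move=> s /andP[ts _]; apply: hc; rewrite in_itv; apply/andP; split; last exact: SSm.
  by apply: lil_scale_le => //; exact: le_variance_int.
have J0 := integral_scale_gt0 fc f0 tt.
have St0 := lil_scale_gt0 (ltW tt).
rewrite sub0r normrN /Lf_quotient (gtr0_norm (divr_gt0 St0 (mulr_gt0 M0 J0))).
rewrite (ler_pdivrMr _ _ (mulr_gt0 M0 J0)); apply: (le_trans (SSm _ (ltW tt))).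
apply: (@le_trans _ _ (e * (M * (f c * (t - t0))))); last first.
  by rewrite (ler_pM2l e0) (ler_pM2l M0).
have eMc : 0 < e * (M * f c) by rewrite !mulr_gt0.
move: te; rewrite -lerBrDr (ler_pdivrMr _ _ eMc) => te.
by rewrite [leRHS](_ : _ = (t - t0) * (e * (M * f c)))//; ring.
Unshelve. all: by end_near. Qed.

Lemma Lf_quotient_small (f : R -> R) (M e : R) : continuous f ->
  (forall x, 0 < x -> 0 < f x) -> 0 < M ->
  Lf_quotient f sigma M t0 t @[t --> +oo] --> (0 : R) -> 0 < e ->
  \forall t \near +oo,
    lil_scale sigma t <= e * (M * \int[leb]_(s in `[t0, t]) f (lil_scale sigma s)).
Proof.
move=> fc f0 M0 hL e0; move/cvgrPdist_le : hL => /(_ _ e0).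
apply: filterS2 (nbhs_pinfty_gt (num_real t0)) => t tt.
have J0 := integral_scale_gt0 fc f0 tt.
have St0 := lil_scale_gt0 (ltW tt).
rewrite sub0r normrN /Lf_quotient (gtr0_norm (divr_gt0 St0 (mulr_gt0 M0 J0))).
by rewrite (ler_pdivrMr _ _ (mulr_gt0 M0 J0)).
Qed.

End after.

Lemma L2_variance_bounded : L2_Rplus sigma -> exists v, forall t, 0 <= t -> V t <= v.
Proof.
rewrite /L2_Rplus => hL.
have i0 : (0 <= \int[leb]_(s in `]0%R, +oo[) (sigma s ^+ 2)%:E)%E.
  by apply: integral_ge0 => s _; rewrite lee_fin sqr_ge0.
have Lfin : (\int[leb]_(s in `]0%R, +oo[) (sigma s ^+ 2)%:E)%E \is a fin_num.
  by rewrite ge0_fin_numE.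
exists (fine (\int[leb]_(s in `]0%R, +oo[) (sigma s ^+ 2)%:E)%E) => t t0.
rewrite -lee_fin (fineK Lfin) -(variance_intE hsigma t).
rewrite -integral_itv_obnd_cbnd; last first.
  apply: measurable_funS (measurable_int _ (integrable_sqr hsigma t)) => //.
  by apply: subset_itv; rewrite bnd_simp.
apply: ge0_subset_integral => //.
- apply/measurable_EFinP; apply: measurable_funX.
  apply: open_continuous_measurable_fun; first exact: interval_open.
  by move=> s; rewrite inE/= in_itv/= andbT => s0; exact: continuous_within_at hsigma s0.
- by move=> s _; rewrite lee_fin sqr_ge0.
- by apply: subset_itv; rewrite bnd_simp.
Qed.

End scale.

(** * The pathwise inequality and the two cases *)

Lemma solution_bound (R : realType) (mu : {measure set (measurableTypeR R) -> \bar R})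
    (f x noise : R -> R) :
  (0 < mu `[0%R, +oo[%classic < +oo)%E -> continuous f ->
  {within `[0, +oo[, continuous x} ->
  (forall t, 0 <= t -> x t = x 0 +
     \int[@lebesgue_measure R]_(s in `[0, t])
       (fine (mu `[0, t - s]%classic) * f (x s)) + noise t) ->
  forall t, 0 <= t -> `|x t| <= `|x 0| + fine (mu `[0, +oo[%classic) *
     \int[@lebesgue_measure R]_(s in `[0, t]) `|f (x s)| + `|noise t|.
Proof.
move=> hmu fc xc eqx t t0; rewrite [in leLHS]eqx//.
apply: (le_trans (ler_normD _ _)); rewrite lerD2r.
apply: (le_trans (ler_normD _ _)); rewrite lerD2l.
exact: (convolution_bound hmu t (continuous_comp_within fc xc)).
Qed.

Theorem theorem3p5 (R : realType) (d : measure_display) (T : measurableType d)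
  (P : probability T R) (filt : R -> set (set T))
  (hfilt : usual_conditions P filt)
  (B : R -> T -> R) (hB : brownian_motion P filt B)
  (mu : {measure set (measurableTypeR R) -> \bar R})
  (hmu : (0 < mu `[0%R, +oo[%classic < +oo)%E)
  (sigma : R -> R) (hsigma : {within `[0, +oo[, continuous sigma})
  (f : R -> R) (hflip : locally_lipschitz f)
  (hfpos : forall x, 0 < x -> 0 < f x)
  (hfinfty : f x @[x --> +oo] --> +oo)
  (hphi : exists phi dphi : R -> R,
    [/\ is_C1_Rplus phi dphi,
        forall x, 0 <= x -> 0 < phi x,
        forall x, 0 <= x -> 0 < dphi x,
        phi x @[x --> +oo] --> +oo & dphi x @[x --> +oo] --> (0 : R)]
    /\ f x / phi x @[x --> +oo] --> (1 : R)
    /\ cvg_at_abs_infty (fun x => `|f x| / phi `|x|) 1)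
  (X : R -> T -> R) (hX : strong_solution P filt B mu f sigma X) :
  let M := fine (mu `[0, +oo[%classic) in
  (~ L2_Rplus sigma ->
    forall t0 : R, 0 <= t0 -> expR 1 < variance_int sigma t0 ->
      Lf_quotient f sigma M t0 t @[t --> +oo] --> (0 : R) ->
      limsup_le1 P f M X)
  /\
  (L2_Rplus sigma ->
    (forall t0 : R, 0 <= t0 -> expR 1 < variance_int sigma t0 ->
      Lf_quotient f sigma M t0 t @[t --> +oo] --> (0 : R))
    /\ limsup_le1 P f M X).
Proof.
move=> M.
have fc := locally_lipschitz_continuous hflip.
have M0 : 0 < M := total_mass_gt0 hmu.
have fle : forall e, 0 < e -> exists2 z0, 1 < z0 &
    forall y z, `|y| <= z -> z0 <= z -> `|f y| <= (1 + e) * f z.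
  have [phi [dphi [[hC1 phi0 dphi0 phioo _] [f1 f2]]]] := hphi.
  exact: (asymptotically_monotone fc hC1).
have [_ cX [I hI eqX]] := hX.
have bounded : (exists v, forall t, 0 <= t -> variance_int sigma t <= v) ->
    limsup_le1 P f M X.
  move=> [v hv]; have aeI := ae_bounded hfilt hB hsigma hI.
  apply: filterS3 cX eqX aeI => w xc eqw /(_ v)[C hC].
  apply: (bounded_noise_growth hfpos fc M0 xc (solution_bound hmu fc xc eqw) fle
    (C := C)).
  by move=> t t0; apply: hC => //; exact: hv.
split=> [_ t0 t00 Vt0 hL|/(L2_variance_bounded hsigma) hV]; last first.
  split=> [t0 t00 Vt0|]; last exact: bounded.
  by have [v hv] := hV; exact: (Lf_quotient_bounded hsigma t00 Vt0 fc hfpos M0 hv).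
have [/bounded//|unbounded] := pselect (exists v,
  forall t, 0 <= t -> variance_int sigma t <= v).
have aeI := ae_iterated_logarithm hfilt hB hsigma hI.
apply: filterS3 cX eqX aeI => w xc eqw [v hv].
(* The iterated logarithm bound starts once the variance passes a level [v] depending on the path;
   unboundedness supplies a time, and monotonicity covers all later ones. *)
have [t1 t10 Vt1] : exists2 t, 0 <= t & v <= variance_int sigma t.
  apply: contrapT => h; apply: unbounded; exists v => t tt0.
  by rewrite leNgt; apply/negP => vt; apply: h; exists t => //; exact: ltW.
have Sc := continuous_lil_scale hsigma t00 Vt0.
have S0 t : t0 <= t -> 0 < lil_scale sigma t by exact: lil_scale_gt0.
apply: (scale_noise_growth hfpos fc M0 xc (solution_bound hmu fc xc eqw) fle t00 Sc
  _ _ (C := 3 * Num.sqrt (12 * expR 1))).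
- by move=> t /S0/ltW.
- by move=> t /S0/hfpos/ltW.
- by rewrite mulr_gt0// sqrtr_gt0 mulr_gt0// expR_gt0.
- apply: filterS (nbhs_pinfty_ge (num_real t1)) => t tt1.
  apply: hv; first exact: le_trans tt1.
  by apply: (le_trans Vt1); exact: le_variance_int.
- by move=> e e0; exact: (Lf_quotient_small hsigma t00 Vt0 fc hfpos M0 hL e0).
Qed.
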